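(* Let $n\ge 1$ and let $l_1,\dots,l_m\in\mathcal{A}_{A_n}(\mathbb{Z}^t)$ be finitely many tropical points. Write $$\prod_{i=1}^m \mathbb{I}_{\mathcal{A}}(l_i)=\sum_{l\in\mathcal{A}_{A_n}(\mathbb{Z}^t)}c(l_1,\dots,l_m;l)\,\mathbb{I}_{\mathcal{A}}(l)$$ for the unique expansion of the product in the canonical basis, and let $S(l_1,\dots,l_m)=\{l\in\mathcal{A}_{A_n}(\mathbb{Z}^t) : c(l_1,\dots,l_m;l)\neq 0\}$ be its support. Then $S(l_1,\dots,l_m)$ is the Minkowski sum of the points $l_1,\dots,l_m$: $$S(l_1,\dots,l_m)=\Big\{x\in\mathcal{A}_{A_n}(\mathbb{Z}^t) : A_{pq}^t(x)\le \sum_{i=1}^m A_{pq}^t(l_i)\ \text{ for every diagonal } \{pq\}\Big\}.$$ Moreover, it is a Stasheff polytope in $\mathcal{A}_{A_n}(\mathbb{Z}^t)$.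
   Context: Polygon. Fix an $(n+3)$-gon with vertices labeled $1,\dots,n+3$ clockwise; vertex indices are read modulo $n+3$. A segment $\{ij\}$ joins two distinct vertices $i,j$; it is an edge if $i,j$ are adjacent and a diagonal otherwise. A partial triangulation $T$ is a (possibly empty) set of pairwise non-crossing diagonals (no intersection in the interior); it is complete if it is maximal. $\widetilde T$ denotes $T$ together with all edges. ''$i,j,k,l$ seated clockwise'' means four distinct vertices occurring in this cyclic clockwise order. (Diagonals correspond bijectively to the set $\Phi_{\ge -1}$ of almost positive roots of type $A_n$, i.e. positive and simple negative roots, with compatibility of roots corresponding to non-crossing; $A_\alpha$ is the variable $A_{ij}$ of the corresponding diagonal.) Positive spaces. A positive space is a variety with a positive atlas of coordinate systems whose transition maps are subtraction-free rational maps. On a positive space $\mathcal{Y}$, $\mathbb{L}_+(\mathcal{Y})$ is the set of functions that are Laurent polynomials with non-negative integer coefficients in every coordinate system. $\mathbf{E}(\mathcal{Y})$ is the set of indecomposable functions: nonzero elements of $\mathbb{L}_+(\mathcal{Y})$ that are not a sum of two nonzero elements of $\mathbb{L}_+(\mathcal{Y})$. The space $\mathcal{A}_{A_n}$. It is the positive space with one coordinate system $\{A_{ij}:\{ij\}\in T\}$ for each complete triangulation $T$, with transition maps generated by the Plücker relations $A_{ik}A_{jl}=A_{ij}A_{kl}+A_{il}A_{jk}$ ($i,j,k,l$ seated clockwise) and by $A_{ij}=1$ for edges. For $\mathbb{A}\in\{\mathbb{Z},\mathbb{R}\}$, a tropical point $x\in\mathcal{A}_{A_n}(\mathbb{A}^t)$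 is a collection of numbers $A_{ij}^t(x)\in\mathbb{A}$, one for each segment, with $A_{ij}^t(x)=0$ for edges and $A_{ik}^t(x)+A_{jl}^t(x)=\max\{A_{ij}^t(x)+A_{kl}^t(x),A_{il}^t(x)+A_{jk}^t(x)\}$ for $i,j,k,l$ seated clockwise. For each complete $T$, the values on $T$ give a bijection $\mathcal{A}_{A_n}(\mathbb{A}^t)\simeq\mathbb{A}^n$. For $F\in\mathbb{L}_+(\mathcal{A}_{A_n})$ nonzero, $F^t(x)$ is the maximum, over the monomials $\prod A_{ij}^{m_{ij}}$ occurring in the expansion of $F$ in any one coordinate system, of $\sum m_{ij}A_{ij}^t(x)$. Minkowski sum of points: $\sum_{i=1}^m l_i=\{x : F^t(x)\le\sum_{i=1}^m F^t(l_i)\text{ for all }F\in\mathbf{E}(\mathcal{A}_{A_n})\}$. Stasheff polytopes. Let $c=\{c_{ij}\}$ be real numbers indexed by the diagonals. For a partial triangulation $T$, let $S(T)$ be the set of diagonals not in $T$ crossing no element of $T$, and put $\mathcal{F}_c^T=\{x\in\mathcal{A}_{A_n}(\mathbb{R}^t) : A_{ij}^t(x)=c_{ij}\ \forall\{ij\}\in T,\ A_{ij}^t(x)\le c_{ij}\ \forall\{ij\}\in S(T)\}$. Then $\mathcal{F}_c^\emptyset$ is a Stasheff polytope if $T_1\subseteq T_2$ implies $\mathcal{F}_c^{T_2}\subseteq\mathcal{F}_c^{T_1}$ for all partial triangulations $T_1,T_2$. A Stasheff polytope in $\mathcal{A}_{A_n}(\mathbb{Z}^t)$ is the intersection of such an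 $\mathcal{F}_c^\emptyset$ with $\mathcal{A}_{A_n}(\mathbb{Z}^t)$. The spaces $\widetilde{\mathcal{A}}_{A_n}$, $\mathcal{X}_{A_n}$. $\widetilde{\mathcal{A}}_{A_n}$ is the positive space with coordinate systems $\{A_{ij}:\{ij\}\in\widetilde T\}$ ($T$ complete), glued via the Plücker relations only (edge variables are free invertible coordinates). $\mathcal{X}_{A_n}$ is the cluster $\mathcal{X}$-variety of type $A_n$: it has one coordinate system $\{X_E^T : E\in T\}$ for each complete triangulation $T$, and a surjective map $k:\widetilde{\mathcal{A}}_{A_n}\to\mathcal{X}_{A_n}$ with $k^*X^T_{\{pr\}}=\dfrac{A_{pq}A_{rs}}{A_{qr}A_{ps}}$, where $p,q,r,s$ (seated clockwise) are the vertices of the quadrilateral formed by the two triangles of $T$ adjacent to $\{pr\}$. The transition maps of $\mathcal{X}_{A_n}$ are those induced through the injection $k^*$, so the field of rational functions $\mathbb{Q}(\mathcal{X}_{A_n})$ is identified with the subfield of $\mathbb{Q}(\widetilde{\mathcal{A}}_{A_n})$ generated by these cross-ratios. The canonical basis. For $l\in\mathcal{A}_{A_n}(\mathbb{Z}^t)$ put $a_{pq}=A_{pq}^t(l)$, $a_{pp}=0$ and $w_{pq}=a_{q-1,p-1}+a_{pq}-a_{p,q-1}-a_{p-1,q}$ for $p\ne q$ (indices mod $n+3$). Then $\mathbb{I}_{\mathcal{A}}(l)$ is the unique element of $\mathbb{Q}(\mathcal{X}_{A_n})$ with $k^*\mathbb{I}_{\mathcal{A}}(l)=\prod_{1\le p<q\le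 n+3}A_{pq}^{w_{pq}}$. The map $\mathbb{I}_{\mathcal{A}}:\mathcal{A}_{A_n}(\mathbb{Z}^t)\to\mathbf{E}(\mathcal{X}_{A_n})$ is a bijection and $\mathbf{E}(\mathcal{X}_{A_n})$ is a $\mathbb{Z}$-basis of the coordinate ring of $\mathcal{X}_{A_n}$ (known facts). *)

(* Defs.v *)
From HB Require Import structures.
From mathcomp Require Import all_boot all_order all_algebra.
From mathcomp Require Import finmap mpoly zify ring.
From mathcomp Require Import boolp classical_sets reals.

Set Implicit Arguments.
Unset Strict Implicit.
Unset Printing Implicit Defensive.

Import Order.TTheory GRing.Theory Num.Theory.
Local Open Scope ring_scope.

(* Vertices are numbered 0, ..., n + 2 clockwise, and addition on 'I_n.+3 is
   addition modulo n + 3; the vertex labelled n + 3 in the literature is 0.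
   A segment {ij} is the two-element set [set i; j]. *)
Notation vertex n := 'I_n.+3.
Notation vset n := {set 'I_n.+3}.

Section Polygon.
Variable n : nat.
Implicit Types (i j k l : vertex n) (d e : vset n) (T : {set vset n}).

Definition is_edge d : bool := [exists i, d == [set i; i + 1]].
Definition is_diagonal d : bool := (#|d| == 2) && ~~ is_edge d.

(* i, j, k, l are seated clockwise *)
Definition cw i j k l : bool :=
  [|| (i < j < k)%N && (k < l)%N, (j < k < l)%N && (l < i)%N,
      (k < l < i)%N && (i < j)%N | (l < i < j)%N && (j < k)%N].

Definition crossing d e : bool :=
  [exists i, exists j, exists k, exists l,
    [&& cw i j k l, d == [set i; k] & e == [set j; l]]].

Definition partial_triangulation T : bool :=
  [forall d in T, is_diagonal d] && [forall d in T, forall e in T, ~~ crossing d e].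

Definition complete_triangulation T : bool := maxset partial_triangulation T.

Definition tilde T : {set vset n} := T :|: [set d | is_edge d].

(* S(T) *)
Definition compatible T : {set vset n} :=
  [set d | [&& is_diagonal d, d \notin T & [forall e in T, ~~ crossing d e]]].

End Polygon.

(* Tropical points. A point is a function on all sets of vertices, which
   vanishes except on diagonals; in particular a [set p; q] is a_pq, with the
   convention a_pp = 0 built in since [set p; p] is not a diagonal. *)
Section Tropical.
Variables (n : nat) (R : realDomainType).

Definition is_trop (a : {ffun vset n -> R}) : bool :=
  [forall d, ~~ is_diagonal d ==> (a d == 0)] &&
  [forall i, forall j, forall k, forall l, cw i j k l ==>
    (a [set i; k] + a [set j; l] ==
     Num.max (a [set i; j] + a [set k; l]) (a [set i; l] + a [set j; k]))].

Record trop := Trop { trop_val :> {ffun vset n -> R}; _ : is_trop trop_val }.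

HB.instance Definition _ := [isSub for trop_val].
HB.instance Definition _ := [Choice of trop by <:].

End Tropical.

Section TropReal.
Variables (n : nat) (R : realDomainType).

Lemma trop_real_subproof (x : trop n int) :
  is_trop ([ffun d => (x d)%:~R] : {ffun vset n -> R}).
Proof.
case: x => a /= /andP[/forallP a0 ap]; apply/andP; split.
  apply/forallP => d; apply/implyP => dd; rewrite ffunE.
  by move: (a0 d); rewrite dd => /eqP ->.
apply/forallP => i; apply/forallP => j; apply/forallP => k; apply/forallP => l.
apply/implyP => c; rewrite !ffunE.
move: ap => /forallP/(_ i)/forallP/(_ j)/forallP/(_ k)/forallP/(_ l).
rewrite c => /eqP h; rewrite -!intrD h; apply/eqP.
by rewrite !maxEle ler_int; case: ifP.
Qed.

(* the inclusion of integral tropical points in real ones *)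
Definition trop_real (x : trop n int) : trop n R := Trop (trop_real_subproof x).

End TropReal.

Section Stasheff.
Variables (n : nat) (R : realType).
Implicit Types (c : vset n -> R) (T : {set vset n}).

Definition face c T : set (trop n R) := [set x |
  (forall d, d \in T -> x d = c d) /\
  (forall d, d \in compatible T -> x d <= c d)]%classic.

(* F_c^{empty set} is a Stasheff polytope; only the values of c at diagonals
   matter *)
Definition stasheff c : Prop :=
  forall T1 T2 : {set vset n},
    partial_triangulation T1 -> partial_triangulation T2 -> T1 \subset T2 ->
    (face c T2 `<=` face c T1)%classic.

Definition integral_stasheff_polytope (S : set (trop n int)) : Prop :=
  exists2 c : vset n -> R, stasheff c &
    S = [set x | face c finset.set0 (trop_real R x)]%classic.

End Stasheff.

(* The segment variables A_ij, all expressed in the coordinate system of the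
   fan triangulation at the vertex 0: given u j = A_{0j} for j > 0 and
   v k = A_{k,k+1} for 0 < k <= n + 1, solving the Pluecker relations for
   0 < i < j gives
     A_ij = u i * u j * sum_(i <= k < j) v k / (u k * u (k + 1)). *)
Section Fan.
Variables (K : fieldType) (n : nat) (u v : nat -> K).

Definition fan_pair (i j : nat) : K :=
  if i is 0 then u j
  else u i * u j * \sum_(i <= k < j) v k / (u k * u k.+1).

(* enum lists the elements of a set of vertices in increasing order *)
Definition fan_var (d : vset n) : K :=
  if enum d is [:: i; j] then fan_pair i j else 1.

Lemma sorted_enum_vset (d : vset n) :
  sorted (fun a b : vertex n => (a < b)%N) (enum d).
Proof.
apply: sorted_filter; first by move=> a b c; apply: ltn_trans.
have := iota_ltn_sorted 0 n.+3; rewrite -val_enum_ord sorted_map.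
by rewrite enumT.
Qed.

Lemma enum_pair (i j : vertex n) : (i < j)%N -> enum [set i; j] = [:: i; j].
Proof.
move=> ij; have ltrans : transitive (fun a b : vertex n => (a < b)%N).
  by move=> a b c; apply: ltn_trans.
apply: (irr_sorted_eq ltrans) => //=.
- exact: sorted_enum_vset.
- by rewrite ij.
- by move=> a; rewrite mem_enum !inE.
Qed.

Lemma fan_varE (i j : vertex n) :
  (i < j)%N -> fan_var [set i; j] = fan_pair i j.
Proof. by move=> ij; rewrite /fan_var enum_pair. Qed.

Lemma fan_var1 (i : vertex n) : fan_var [set i] = 1.
Proof. by rewrite /fan_var enum_set1. Qed.

Hypothesis u_neq0 : forall k, u k != 0.

Lemma fan_pair_plucker (i j k l : nat) : (i < j < k)%N -> (k < l)%N ->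
  fan_pair i k * fan_pair j l =
  fan_pair i j * fan_pair k l + fan_pair i l * fan_pair j k.
Proof.
move=> /andP[ij jk] kl.
have H a b c : (a <= b <= c)%N ->
    \sum_(a <= t < c) v t / (u t * u t.+1) =
    \sum_(a <= t < b) v t / (u t * u t.+1) +
    \sum_(b <= t < c) v t / (u t * u t.+1).
  by case/andP=> *; apply: big_cat_nat.
case: j ij jk => // j ij jk; case: k jk kl => // k jk kl.
case: l kl => // l kl; case: i ij => [|i] ij; rewrite /fan_pair.
  by rewrite (H j.+1 k.+1 l.+1); [ring | lia].
rewrite (H i.+1 j.+1 k.+1) ?(H i.+1 j.+1 l.+1) ?(H j.+1 k.+1 l.+1); try lia.
ring.
Qed.

Lemma fan_plucker_lt (i j k l : vertex n) : (i < j < k)%N -> (k < l)%N ->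
  fan_var [set i; k] * fan_var [set j; l] =
  fan_var [set i; j] * fan_var [set k; l] +
  fan_var [set i; l] * fan_var [set j; k].
Proof.
move=> ijk kl; have /andP[ij jk] := ijk.
have il := ltn_trans ij (ltn_trans jk kl).
rewrite !fan_varE ?(ltn_trans ij jk) ?(ltn_trans jk kl) //.
exact: fan_pair_plucker.
Qed.

Lemma fan_plucker (i j k l : vertex n) : cw i j k l ->
  fan_var [set i; k] * fan_var [set j; l] =
  fan_var [set i; j] * fan_var [set k; l] +
  fan_var [set i; l] * fan_var [set j; k].
Proof.
have C (a b : vertex n) : [set a; b] = [set b; a] by rewrite finset.setUC.
case/or4P=> /andP[h1 h2].
- exact: fan_plucker_lt.
- have := fan_plucker_lt h1 h2; rewrite (C k i) (C l i) (C j i) => E.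
  by rewrite mulrC E; ring.
- have := fan_plucker_lt h1 h2.
  by rewrite (C k i) (C l i) (C l j) (C k j) => ->; ring.
- have := fan_plucker_lt h1 h2.
  rewrite (C l i) (C l j) (C l k) => E.
  by rewrite mulrC E; ring.
Qed.

Lemma fan_edge (k : nat) : (0 < k)%N -> fan_pair k k.+1 = v k.
Proof.
case: k => // k _; rewrite /fan_pair big_nat1 mulrC divfK //.
by rewrite mulf_neq0.
Qed.

End Fan.

Section Vertices.
Variable n : nat.

Lemma vertexS (i : vertex n) :
  nat_of_ord (i + 1) = if (i < n.+2)%N then i.+1 else 0%N.
Proof.
rewrite /= addn1; case: ltnP => h; first by rewrite modn_small.
have -> : nat_of_ord i = n.+2 by have := ltn_ord i; lia.
by rewrite modnn.
Qed.

Lemma set2_eq (p q i k : vertex n) : [set p; q] == [set i; k] ->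
  i = p /\ k = q \/ i = q /\ k = p.
Proof.
move=> /eqP/esym E.
have : i \in [set p; q] by rewrite -E set21.
have : k \in [set p; q] by rewrite -E set22.
have : p \in [set i; k] by rewrite E set21.
have : q \in [set i; k] by rewrite E set22.
by rewrite !inE => /orP[]/eqP e1 /orP[]/eqP e2 /orP[]/eqP e3 /orP[]/eqP e4; subst; auto.
Qed.

Lemma diagonal_quad (p q : vertex n) : (p < q)%N -> is_diagonal [set p; q] ->
  let S := [set d in [set [set p; q]; [set p + 1; q]; [set p; q + 1]] |
             is_diagonal d] in
  cw p (p + 1) q (q + 1) /\ partial_triangulation S.
Proof.
move=> pq /andP[_ /existsPn ne] S.
have ps := vertexS p; have qs := vertexS q.
have lp := ltn_ord p; have lq := ltn_ord q.
have n1 : p.+1 != q.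
  apply: contra (ne p) => /eqP h; rewrite (_ : p + 1 = q) //.
  by apply: ord_inj; rewrite ps; case: ltnP; lia.
have n2 : (0 < p)%N || (q < n.+2)%N.
  apply: contraT => h; have := ne q; rewrite finset.setUC (_ : q + 1 = p) ?eqxx //.
  by apply: ord_inj; rewrite qs; case: ltnP; lia.
have c : cw p (p + 1) q (q + 1).
  by rewrite /cw ps qs; case: (ltnP p n.+2); case: (ltnP q n.+2); lia.
split=> //; apply/andP; split.
  by apply/forallP => d; apply/implyP; rewrite inE => /andP[].
apply/forallP => d; apply/implyP; rewrite inE => /andP[dS _].
apply/forallP => e; apply/implyP; rewrite inE => /andP[eS _].
apply/negP => /existsP[i] /existsP[j] /existsP[k] /existsP[l] /and3P[cc].
move: dS eS; rewrite !inE -!orbA => /or3P[]/eqP-> /or3P[]/eqP-> /set2_eq h1 /set2_eq h2;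
 move: cc; rewrite /cw; (case: h1 => -[-> ->]); (case: h2 => -[-> ->]);
 rewrite ?ps ?qs; case: (ltnP p n.+2); case: (ltnP q n.+2); lia.
Qed.

Lemma prod_lt_shift (K : comNzRingType) (f : vertex n -> vertex n -> K) :
  (forall p q, f p q = f q p) ->
  \prod_(p : vertex n) \prod_(q : vertex n | (p < q)%N) f p q =
  \prod_(p : vertex n) \prod_(q : vertex n | (p < q)%N) f (p + 1) (q + 1).
Proof.
move=> fC; rewrite !pair_big_dep /=.
pose srt (x : vertex n * vertex n) := if (x.1 < x.2)%N then x else (x.2, x.1).
have fsrt x : f (srt x).1 (srt x).2 = f x.1 x.2 by rewrite /srt; case: ifP.
have srtC a b : srt (a, b) = srt (b, a).
  by rewrite /srt; case: ltngtP => //= /ord_inj ->.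
have srtD x z : srt ((srt x).1 + z, (srt x).2 + z) = srt (x.1 + z, x.2 + z).
  by rewrite {2 3}/srt; case: ifP => // _; exact: srtC.
have pr1 (a b : vertex n) : (a, b).1 = a by [].
have pr2 (a b : vertex n) : (a, b).2 = b by [].
have srt_id x : (srt x == x) = (x.1 <= x.2)%N.
  case: x => a b; rewrite /srt /=; case: ifP => ab; first by rewrite eqxx (ltnW ab).
  rewrite xpair_eqE -!val_eqE /=. lia.
have srt_lt x : ((srt x).1 < (srt x).2)%N = (x.1 != x.2).
  by rewrite /srt -val_eqE /=; case: ifP => /=; lia.
rewrite (reindex_onto (fun x => srt (x.1 + 1, x.2 + 1))
                      (fun x => srt (x.1 - 1, x.2 - 1))); last first.
  move=> x ltx; rewrite srtD pr1 pr2 !subrK.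
  by rewrite -surjective_pairing; apply/eqP; rewrite srt_id ltnW.
apply: eq_big => [x|x _]; last by rewrite fsrt.
rewrite srt_lt srtD pr1 pr2 !addrK.
rewrite -surjective_pairing srt_id (inj_eq (addIr _)) -val_eqE.
by rewrite [RHS]ltn_neqAle.
Qed.

Lemma prod_all_pairs (K : comNzRingType) (g : vertex n -> vertex n -> K) :
  (forall p, g p p = 1) ->
  \prod_(p : vertex n) \prod_(q : vertex n) g p q =
  \prod_(p : vertex n) \prod_(q : vertex n | (p < q)%N) (g p q * g q p).
Proof.
move=> g1.
transitivity (\prod_(p : vertex n) ((\prod_(q : vertex n | (p < q)%N) g p q) *
  \prod_(q : vertex n | (q < p)%N) g p q)).
  apply: eq_bigr => p _; rewrite (bigD1 p) //= g1 mul1r.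
  rewrite (bigID (fun q : vertex n => (p < q)%N)) /=.
  by congr (_ * _); apply: eq_bigl => q; rewrite -val_eqE /=; lia.
rewrite big_split /= [X in _ * X](exchange_big_dep xpredT) //= -big_split /=.
by apply: eq_bigr => p _; rewrite big_split.
Qed.

End Vertices.

Section Positive.
Variable N : nat.
Local Notation "p %:F" := (@FracField.tofrac _ p).

Definition indet (k : nat) : {fraction {mpoly rat[N]}} :=
  if insub k is Some i then ('X_i)%:F else 1.

(* f is a ratio of two polynomials that are positive at (1, ..., 1) *)
Definition posf (f : {fraction {mpoly rat[N]}}) : Prop :=
  exists p q : {mpoly rat[N]},
    [/\ 0 < p.@[fun=> 1], 0 < q.@[fun=> 1] & f = p%:F / q%:F].

Lemma tofrac_pos_neq0 (p : {mpoly rat[N]}) : 0 < p.@[fun=> 1] -> p%:F != 0.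
Proof.
move=> p0; rewrite tofrac_eq0; apply: contraTneq p0 => ->.
by rewrite meval0 ltxx.
Qed.

Lemma posf_neq0 f : posf f -> f != 0.
Proof.
case=> p [q [p0 q0 ->]].
by rewrite mulf_neq0 ?invr_eq0 ?tofrac_pos_neq0.
Qed.

Lemma posf1 : posf 1.
Proof. by exists 1, 1; rewrite meval1 ltr01 divff ?tofrac1 ?oner_neq0. Qed.

Lemma posf_indet k : posf (indet k).
Proof.
rewrite /indet; case: insub => [i|]; last exact: posf1.
by exists 'X_i, 1; rewrite mevalXU meval1 ltr01 tofrac1 divr1.
Qed.

Lemma posfM f g : posf f -> posf g -> posf (f * g).
Proof.
case=> p [q [p0 q0 ->]] [r [s [r0 s0 ->]]].
exists (p * r), (q * s); rewrite !mevalM !mulr_gt0 //; split=> //.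
by rewrite !tofracM mulf_div.
Qed.

Lemma posfV f : posf f -> posf f^-1.
Proof. by case=> p [q [p0 q0 ->]]; exists q, p; rewrite invf_div. Qed.

Lemma posfD f g : posf f -> posf g -> posf (f + g).
Proof.
case=> p [q [p0 q0 ->]] [r [s [r0 s0 ->]]].
exists (p * s + r * q), (q * s).
rewrite mevalD !mevalM addr_gt0 ?mulr_gt0 //; split=> //.
by rewrite tofracD !tofracM addf_div // tofrac_pos_neq0.
Qed.

Lemma posf_fan_var n u v (d : vset n) :
  (forall k, posf (u k)) -> (forall k, posf (v k)) -> posf (fan_var u v d).
Proof.
move=> u0 v0; rewrite /fan_var; move: (sorted_enum_vset d).
case: (enum d) => [|i [|j [|k s]]] //=; try by move=> *; exact: posf1.
rewrite andbT /fan_pair => ij.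
case: (nat_of_ord i) ij => [//|a] ab; apply: posfM; first exact: posfM.
elim: (nat_of_ord j) ab => // b IH; rewrite ltnS leq_eqVlt => /orP[/eqP <-|ab].
  by rewrite big_nat1; do !(apply: posfM || apply: posfV).
rewrite big_nat_recr /=; last exact: ltnW.
apply: posfD; first exact: IH.
by do !(apply: posfM || apply: posfV).
Qed.

End Positive.

(* A_{A_n}: the edge variables are 1, and the function field is freely
   generated by the diagonals A_{0,k+2} = indet k (k < n) of the fan
   triangulation. *)
Section ASpace.
Variable n : nat.

Definition QA : fieldType := {fraction {mpoly rat[n]}}.

Definition Avar (d : vset n) : QA :=
  fan_var (fun k => if (2 <= k <= n.+1)%N then indet n (k - 2) else 1)
          (fun=> 1) d.

Lemma A_neq0 d : Avar d != 0.
Proof.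
apply/posf_neq0/posf_fan_var => k; last exact: posf1.
by case: ifP => _; [exact: posf_indet | exact: posf1].
Qed.

Lemma A_plucker (i j k l : vertex n) : cw i j k l ->
  Avar [set i; k] * Avar [set j; l] =
  Avar [set i; j] * Avar [set k; l] + Avar [set i; l] * Avar [set j; k].
Proof. exact: fan_plucker. Qed.

Lemma A_edge (d : vset n) : is_edge d -> Avar d = 1.
Proof.
case/existsP => i /eqP ->; rewrite /Avar.
set u := fun k => _; set v := fun _ : nat => _.
have u0 k : u k != 0.
  by rewrite /u; case: ifP => _; [exact/posf_neq0/posf_indet | exact: oner_neq0].
have := vertexS i; case: ltnP => [ip|pi] ip'.
  rewrite fan_varE ip' //; case: (posnP i) => [->|i0].
    by rewrite /fan_pair /u.
  by rewrite fan_edge.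
rewrite finset.setUC fan_varE ip' /fan_pair; last by have := ltn_ord i; lia.
by rewrite /u ifF //; have := ltn_ord i; lia.
Qed.

Local Notation coefs := {fsfun {ffun vset n -> int} -> nat with 0%N}.

(* c is the Laurent expansion of F in the coordinates A_d, d in T: the
   coefficient of the monomial \prod_(d in T) A_d ^ m d is c m *)
Definition laurent (T : {set vset n}) (F : QA) (c : coefs) : Prop :=
  (forall m, m \in finsupp c -> forall d, d \notin T -> m d = 0) /\
  F = \sum_(m <- finsupp c) (\prod_(d in T) Avar d ^ m d) *+ c m.

Definition Lplus : set QA := [set F | forall T : {set vset n},
  complete_triangulation T -> exists c, laurent T F c]%classic.

Definition indecomposable : set QA := [set F | [/\ Lplus F, F != 0 &
  ~ exists G H, [/\ Lplus G, Lplus H, G != 0, H != 0 & F = G + H]]]%classic.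

(* v is the maximum of the tropical values at x of the monomials of c *)
Definition trop_max (c : coefs) (x : trop n int) (v : int) : Prop :=
  (exists2 m, m \in finsupp c & v = \sum_d m d * x d) /\
  (forall m, m \in finsupp c -> \sum_d m d * x d <= v).

(* F^t(x), computed in any coordinate system *)
Definition tropicalize (F : QA) (x : trop n int) : int :=
  xget 0 [set v | exists T c,
    [/\ complete_triangulation T, laurent T F c & trop_max c x v]]%classic.

Definition minkowski_sum (m : nat) (l : 'I_m -> trop n int) :
  set (trop n int) :=
  [set x | forall F, indecomposable F ->
    tropicalize F x <= \sum_(i < m) tropicalize F (l i)]%classic.

End ASpace.

(* The function field of the space with free edge variables is freely
   generated by the A_{0,k+1} = indet k (k < n + 2) and the
   A_{k,k+1} = indet (n + 1 + k) (0 < k <= n + 1). *)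
Section XSpace.
Variable n : nat.

Definition QAt : fieldType := {fraction {mpoly rat[n.*2.+3]}}.

Definition Atvar (d : vset n) : QAt :=
  fan_var (fun k => indet n.*2.+3 k.-1) (fun k => indet n.*2.+3 (n.+1 + k)) d.

Lemma At_neq0 d : Atvar d != 0.
Proof. by apply/posf_neq0/posf_fan_var => k; exact: posf_indet. Qed.

Lemma At_plucker (i j k l : vertex n) : cw i j k l ->
  Atvar [set i; k] * Atvar [set j; l] =
  Atvar [set i; j] * Atvar [set k; l] + Atvar [set i; l] * Atvar [set j; k].
Proof. exact: fan_plucker. Qed.

(* f is the pull-back by k of the coordinate X^T_{pr}, where p, q, r, s are the
   vertices of the quadrilateral formed by the two triangles of T at {pr} *)
Definition X_coord (T : {set vset n}) (p r : vertex n) (f : QAt) : Prop :=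
  exists q s, [/\ cw p q r s, [set p; r] \in T,
    [&& [set p; q] \in tilde T, [set q; r] \in tilde T,
        [set r; s] \in tilde T & [set p; s] \in tilde T] &
    f = Atvar [set p; q] * Atvar [set r; s] / (Atvar [set q; r] * Atvar [set p; s])].

(* the subfield generated by all the X-coordinates *)
Inductive QX_gen : QAt -> Prop :=
| QX_coord T p r f of complete_triangulation T & X_coord T p r f : QX_gen f
| QX_1 : QX_gen 1
| QX_sub f g of QX_gen f & QX_gen g : QX_gen (f - g)
| QX_div f g of QX_gen f & QX_gen g : QX_gen (f / g).

Definition QX_pred : {pred QAt} := fun f => `[< QX_gen f >].

Lemma QX_divring : divring_closed QX_pred.
Proof.
split; first exact/asboolP/QX_1.
  by move=> f g /asboolP hf /asboolP hg; apply/asboolP/QX_sub.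
by move=> f g /asboolP hf /asboolP hg; apply/asboolP/QX_div.
Qed.

HB.instance Definition _ := GRing.isDivringClosed.Build QAt QX_pred QX_divring.

(* Q(X), with the injection k^* to the function field above *)
Record QX := MkQX { k_star : QAt; _ : k_star \in QX_pred }.

HB.instance Definition _ := [isSub for k_star].
HB.instance Definition _ := [Choice of QX by <:].
HB.instance Definition _ := [SubChoice_isSubIntegralDomain of QX by <:].

Lemma QX_unit : {mono (val : QX -> QAt) : f / f \in GRing.unit}.
Proof.
move=> f; apply/idP/idP => [uf|]; last by move/(rmorph_unit val).
have fV : (val f)^-1 \in QX_pred.
  by case: QX_divring => h1 _ hV; rewrite -div1r; apply: hV => //; exact: valP.
apply/unitrPr; exists (MkQX fV).
by apply: val_inj; rewrite rmorphM rmorph1 /= mulrV.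
Qed.

HB.instance Definition _ := GRing.SubIntegralDomain_isSubField.Build _ _ QX QX_unit.

Definition IA_exponent (a : vset n -> int) (p q : vertex n) : int :=
  a [set q - 1; p - 1] + a [set p; q] - a [set p; q - 1] - a [set p - 1; q].

Definition IA_monomial (l : trop n int) : QAt :=
  \prod_(p : vertex n) \prod_(q : vertex n | (p < q)%N)
    Atvar [set p; q] ^ IA_exponent l p q.

Lemma cross_ratio_QX (p q : vertex n) : (p < q)%N -> is_diagonal [set p; q] ->
  Atvar [set p; q] * Atvar [set p + 1; q + 1] /
    (Atvar [set p; q + 1] * Atvar [set q; p + 1]) \in QX_pred.
Proof.
move=> pq dpq; have [c pt] := diagonal_quad pq dpq.
have [T Tmax sT] := maxset_exists pt.
rewrite (At_plucker c) mulrDl [X in _ + X / _]mulrC.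
rewrite [[set p + 1; q]]finset.setUC [X in _ + X / _]mulrC divff; last first.
  by rewrite mulf_neq0 ?At_neq0.
rewrite rpredD ?rpred1 //; apply/asboolP.
apply: (QX_coord (T := T) (p := p) (r := q)) => //.
have tT d : d \in [set [set p; q]; [set p + 1; q]; [set p; q + 1]] ->
    #|d| == 2 -> d \in tilde T.
  move=> dS d2; rewrite !inE; case: (boolP (is_edge d)) => e; rewrite ?orbT // orbF.
  by apply: (fintype.subsetP sT); rewrite inE dS /is_diagonal d2.
exists (p + 1), (q + 1); split=> //.
- by apply: (fintype.subsetP sT); rewrite !inE eqxx.
- have E (i : vertex n) : [set i; i + 1] \in tilde T.
    by rewrite !inE; apply/orP; right; apply/existsP; exists i.
  rewrite !E !tT ?inE ?eqxx ?orbT //= cards2; have := c; rewrite /cw -val_eqE /=; lia.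
- by rewrite [[set p + 1; q]]finset.setUC [in RHS](mulrC (Atvar [set q; p + 1])).
Qed.

Lemma IA_subproof (l : trop n int) : IA_monomial l \in QX_pred.
Proof.
have SC (a b : vertex n) : [set a; b] = [set b; a] by rewrite finset.setUC.
have l0 d : ~~ is_diagonal d -> l d = 0.
  by case: l => a /= /andP[/forallP a0 _] dd; apply/eqP/(implyP (a0 d)).
have l1 p : l [set p; p] = 0.
  by apply: l0; rewrite finset.setUid /is_diagonal cards1.
pose G p q := Atvar [set p; q] ^ l [set p; q - 1].
pose H p q := Atvar [set p; q] ^ l [set q - 1; p - 1].
have -> : IA_monomial l =
    \prod_(p : vertex n) \prod_(q : vertex n | (p < q)%N)
    (H p q * Atvar [set p; q] ^ l [set p; q] / (G p q * G q p)).
  apply: eq_bigr => p _; apply: eq_bigr => q _.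
  rewrite /IA_exponent /G /H -addrA -opprD !expfzDr ?At_neq0 //.
  by rewrite -invr_expz expfzDr ?At_neq0 // (SC q p) (SC q (p - 1)).
have prodD F1 F2 : \prod_(p : vertex n) \prod_(q : vertex n | (p < q)%N)
    (F1 p q * F2 p q) =
    (\prod_(p : vertex n) \prod_(q : vertex n | (p < q)%N) F1 p q) *
    (\prod_(p : vertex n) \prod_(q : vertex n | (p < q)%N) F2 p q) :> QAt.
  by rewrite -big_split; apply: eq_bigr => p _; rewrite big_split.
have prodV F1 : \prod_(p : vertex n) \prod_(q : vertex n | (p < q)%N)
    (F1 p q)^-1 =
    (\prod_(p : vertex n) \prod_(q : vertex n | (p < q)%N) F1 p q)^-1 :> QAt.
  by rewrite -prodfV; apply: eq_bigr => p _; rewrite prodfV.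
have G1 p : G p p = 1 by rewrite /G finset.setUid /Atvar fan_var1 exp1rz.
rewrite !prodD prodV -(prod_all_pairs G1).
rewrite (prod_lt_shift (f := H)); last by move=> p q; rewrite /H SC (SC (q - 1)).
pose G' p q := Atvar [set p; q + 1] ^ l [set p; q].
have -> : \prod_(p : vertex n) \prod_(q : vertex n) G p q =
    \prod_(p : vertex n) \prod_(q : vertex n) G' p q.
  apply: eq_bigr => p _; rewrite (reindex_inj (addIr (1 : vertex n))) /=.
  by apply: eq_bigr => q _; rewrite /G addrK.
rewrite (prod_all_pairs (g := G')); last by move=> p; rewrite /G' l1 expr0z.
rewrite -prodV -!prodD; apply: rpred_prod => p _; apply: rpred_prod => q pq.
rewrite /H /G' !addrK (SC q p).
case: (boolP (is_diagonal [set p; q])) => [dpq|/l0 ->]; last first.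
  by rewrite !expr0z !mulr1 divr1 rpred1.
have := cross_ratio_QX pq dpq; move: (l _) => a.
rewrite -!expfzMl invr_expz -exprz_inv -expfzMl [Atvar [set p + 1; q + 1] * _]mulrC.
move: (_ * _ / _) => f fQ; case: a => k; first exact: rpredX.
by rewrite NegzE -exprz_inv; apply: rpredX; rewrite rpredV.
Qed.

Definition IA (l : trop n int) : QX := MkQX (IA_subproof l).

(* c is the expansion of f in the canonical basis *)
Definition canonical_expansion (f : QX) (c : {fsfun trop n int -> int with 0}) :
  Prop :=
  f = \sum_(l <- finsupp c) IA l *~ c l.

End XSpace.

(* Main.v *)
From mathcomp Require Import mpoly zify ring lra.
Require Import Defs.
From mathcomp Require Import all_boot all_order all_algebra.
From mathcomp Require Import finmap.
From mathcomp Require Import boolp classical_sets reals.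

Set Implicit Arguments.
Unset Strict Implicit.
Unset Printing Implicit Defensive.

Import Order.TTheory GRing.Theory Num.Theory.
Local Open Scope ring_scope.

(** The monomial IA(l) is a product of segment variables whose exponents
    w_pq are the mixed second differences of l. On the diagonals they are
    nonnegative and supported on pairwise noncrossing diagonals, and conversely a
    function that vanishes off the diagonals and has such second differences is a
    tropical point (lemmas [tropical_noncrossing] and [noncrossing_tropical]). So
    the canonical basis consists of noncrossing monomials of degree 0 at each
    vertex, and a product of IA(l_i) is the monomial of the function a = sum l_i, for
    which w is still nonnegative on the diagonals but may have crossings.

    Applying a Pluecker relation to a crossing ik, jl of this monomial gives a sum of
    two monomials. In terms of functions, a is replaced by a - chi, where chi is the
    indicator of the chords that separate the two segments put in from each other.
    A tropical point x <= a satisfies x <= a - chi for one of the two choices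
    of chi: otherwise x would agree with a on two crossing chords, which the Pluecker
    relation for x forbids, because the sum of the values of a on these chords exceeds
    both of the sums that the relation compares ([trop_le_resolution]). When no crossing is left, a is tropical, and the only
    tropical point below it is a itself ([trop_le_eq]). Hence the points of the
    expansion are exactly the tropical points x <= sum l_i
    ([skein_expansion]). The expansion is unique because along a suitable path of
    evaluations the monomials IA(l) have different rates of growth
    ([IA_monomial_free]).

    For the Minkowski sum, the variables A_d are indecomposable and have tropical
    value x_d at x ([Avar_indecomposable], [tropicalize_Avar]), which gives one
    inclusion. For the other, it must be shown that F^t(x) <= sum F^t(l_i) for all
    nonzero F in L_+ as soon as x <= sum l_i. It is enough to consider points x in the
    interior of a cone of linearity ([tropicalize_subadditive]), and to support
    F^t from below at such a point by a combination of coordinates with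
    nonnegative coefficients ([supporting_monomial]). Take a monomial of F that is
    maximal at x. On the cone around x it is the pairing of the second differences of a
    point with the values of some function y, which may be chosen tropical, so that
    summation by parts turns it into a nonnegative combination of coordinates in the
    triangulation that carries the second differences of y. In that chart F^t is
    convex, so the bound, which holds near x, holds everywhere. The existence of y
    rests on the fact that the values of a tropical function on a triangulation can be
    prescribed ([tropical_extension]), which is proved by flips.

    Finally the functions c = sum l_i satisfy the Pluecker relations as
    inequalities, and this makes the faces of the polytope nested: an
    equality x_jl = c_jl bounds every diagonal that crosses jl by the sides of a
    quadrilateral ([stasheff_plucker]). *)

(** * Lifting cyclic positions to natural numbers *)

Section Lift.
Variable n : nat.
Local Notation N := n.+3.
Implicit Types (i j k l : vertex n).

Definition vx (p : nat) : vertex n := inZp p.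

Lemma vx_ord (i : vertex n) : vx i = i.
Proof. exact: valZpK. Qed.

Lemma vxS p : vx p.+1 = vx p + 1.
Proof. by apply: val_inj; rewrite /= modnDmr addn1 -(addn1 (p %% _)) modnDml addn1. Qed.

Lemma vxDN p : vx (p + N) = vx p.
Proof. by apply: val_inj; rewrite /= modnDr. Qed.

Lemma vx_small p : (p < N)%N -> vx p = p :> nat.
Proof. by move=> h; rewrite /= modn_small. Qed.

Lemma vx_window a (p : vertex n) : exists2 P : nat, (a <= P < a + N)%N & p = vx P.
Proof.
exists (a + (p + N - a %% N) %% N)%N.
  by rewrite leq_addr ltn_add2l ltn_pmod.
apply: val_inj => /=; rewrite modnDmr; have h : (a %% N <= p + N)%N.
  by have := ltn_pmod a (isT : (0 < N)%N); lia.
rewrite -modnDml addnC subnK // modnDr modn_small //.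
Qed.

Lemma vx_inj P Q : (P < Q + N)%N -> (Q < P + N)%N -> vx P = vx Q -> P = Q.
Proof.
wlog PQ : P Q / (P <= Q)%N.
  by move=> h a b c; case/orP: (leq_total P Q) => u; [exact: h | symmetry; exact: h].
move=> _ QP /(congr1 val) /eqP; rewrite /= /vx /=.
have -> : Q = (Q - P + P)%N by rewrite subnK.
rewrite eq_sym -{3}(add0n P) eqn_modDr mod0n modn_small; last by lia.
by move=> h; lia.
Qed.

(** Vertices read off a window of n + 3 consecutive natural numbers are seated
    clockwise in the order of these numbers, and every clockwise quadruple lifts
    to such a window: cyclic arcs become intervals, over which sums telescope. *)
Lemma cw_vx P Q R S : (P < Q < R)%N -> (R < S < P + N)%N ->
  cw (vx P) (vx Q) (vx R) (vx S).
Proof.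
wlog PN : P Q R S / (P < N)%N.
  move=> H; rewrite (divn_eq P N).
  set c := (P %/ N * N)%N; set P0 := (P %% N)%N => h1 h2.
  have E X : (c <= X)%N -> vx X = vx (X - c).
    move=> cX; apply: val_inj => /=; rewrite -{1}(subnK cX) addnC /c modnMDl.
    by [].
  rewrite (E Q) 1?(E R) 1?(E S) 1?(E (c + P0)%N); try lia.
  by apply: H; try lia; have := ltn_pmod P (isT : (0 < N)%N); lia.
have V X : (X < N + N)%N -> vx X = (if X < N then X else X - N)%N :> nat.
  move=> h2; case: ltnP => h; first exact: vx_small.
  have -> : vx X = vx (X - N) by rewrite -(vxDN (X - N)) subnK.
  by rewrite vx_small //; lia.
move=> /andP[h1 h2] /andP[h3 h4]; rewrite /cw (V P) ?(V Q) ?(V R) ?(V S); try lia.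
rewrite PN; case: (ltnP Q N) => hQ; last first.
  by rewrite !ifF; try lia; apply/or4P/Or42; apply/andP; lia.
case: (ltnP R N) => hR; last first.
  by rewrite !ifF; try lia; apply/or4P/Or43; apply/andP; lia.
case: (ltnP S N) => hS; last by apply/or4P/Or44; apply/andP; lia.
by apply/or4P/Or41; apply/andP; lia.
Qed.

Lemma cw_lift i j k l : cw i j k l -> exists P Q R S : nat,
  [/\ (P < Q < R)%N, (R < S < P + N)%N, i = vx P, j = vx Q & k = vx R /\ l = vx S].
Proof.
have := (ltn_ord i, ltn_ord j, ltn_ord k, ltn_ord l).
case=> [[[hi hj] hk] hl] /or4P[]/andP[h1 h2].
- by exists i, j, k, l; rewrite !vx_ord; split=> //; lia.
- by exists i, (j + N)%N, (k + N)%N, (l + N)%N; rewrite !vxDN !vx_ord; split=> //; lia.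
- by exists i, j, (k + N)%N, (l + N)%N; rewrite !vxDN !vx_ord; split=> //; lia.
- by exists i, j, k, (l + N)%N; rewrite !vxDN !vx_ord; split=> //; lia.
Qed.

End Lift.

(** * Tropical functions and second differences *)

Section Diagonals.
Variable n : nat.
Local Notation N := n.+3.
Implicit Types (i j k l p q : vertex n).

Lemma is_diagonal_pair p q :
  is_diagonal [set p; q] = [&& p != q, q != p + 1 & p != q + 1].
Proof.
rewrite /is_diagonal cards2; case: (eqVneq p q) => //= _.
apply/idP/idP => [/existsPn h|/andP[h1 h2]]; last apply/existsPn => i.
  apply/andP; split; apply/eqP => e; first by have := h p; rewrite e eqxx.
  by have := h q; rewrite e finset.setUC eqxx.
by apply/negP => /set2_eq [[e1 e2]|[e1 e2]]; subst; rewrite eqxx in h1 h2.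
Qed.

Lemma is_diagonal_card d : @is_diagonal n d -> #|d| = 2%N.
Proof. by case/andP => /eqP. Qed.

Lemma diagonal_vx P Q : (P.+1 < Q)%N -> (Q.+1 < P + N)%N ->
  is_diagonal [set vx n P; vx n Q].
Proof.
move=> h1 h2; rewrite is_diagonal_pair -!vxS; apply/and3P; split; apply/eqP.
- by move/vx_inj; lia.
- by move/vx_inj; lia.
- by rewrite -(vxDN n P) => /vx_inj; lia.
Qed.

Lemma cw_diagonal i j k l : cw i j k l -> is_diagonal [set i; k].
Proof. by case/cw_lift=> P [Q] [R] [S] [h1 h2 -> _ [-> _]]; apply: diagonal_vx; lia. Qed.

Lemma cw_rot i j k l : cw i j k l = cw j k l i.
Proof. by rewrite /cw; lia. Qed.

Lemma diagonal_cw p q : is_diagonal [set p; q] -> cw p (p + 1) q (q + 1).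
Proof.
have [Q hQ ->] := vx_window p q; have := vx_ord p.
move: (nat_of_ord p) hQ => P hQ <-; rewrite is_diagonal_pair -!vxS => /and3P[/eqP h1 /eqP h2 /eqP h3].
have n1 : Q <> P by move=> E; rewrite E in h1.
have n2 : Q <> P.+1 by move=> E; rewrite E in h2.
have n3 : Q.+1 <> (P + N)%N by move=> E; rewrite E vxDN in h3.
by apply: cw_vx; lia.
Qed.

Lemma crossingP d e : reflect (exists i j k l : vertex n,
  [/\ cw i j k l, d = [set i; k] & e = [set j; l]]) (crossing d e).
Proof.
apply: (iffP existsP) => [[i /existsP[j /existsP[k /existsP[l /and3P[c /eqP ? /eqP ?]]]]]|].
  by exists i, j, k, l.
move=> [i [j [k [l [c -> ->]]]]]; exists i; apply/existsP; exists j.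
by apply/existsP; exists k; apply/existsP; exists l; rewrite c !eqxx.
Qed.

Lemma crossingC d e : @crossing n d e = crossing e d.
Proof.
apply/crossingP/crossingP => -[i [j [k [l [c -> ->]]]]].
  by exists j, k, l, i; rewrite -cw_rot (finset.setUC [set k]).
by exists j, k, l, i; rewrite -cw_rot (finset.setUC [set k]).
Qed.

Lemma card2_pair (d : vset n) : #|d| = 2%N -> exists p q : vertex n, (p < q)%N /\ d = [set p; q].
Proof.
move=> /eqP/cards2P [p [q [pq ->]]].
case: (ltngtP p q) => h; first by exists p, q.
  by exists q, p; rewrite finset.setUC.
by case/eqP: pq; apply: val_inj.
Qed.

End Diagonals.

Section Trop.
Variables (n : nat) (R : realDomainType).

Lemma trop_nondiag (x : trop n R) d : ~~ is_diagonal d -> x d = 0.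
Proof. by case: x => a /= /andP[/forallP a0 _] dd; apply/eqP/(implyP (a0 d)). Qed.

Lemma trop_plucker (x : trop n R) i j k l : cw i j k l ->
  x [set i; k] + x [set j; l] =
  Num.max (x [set i; j] + x [set k; l]) (x [set i; l] + x [set j; k]).
Proof.
move=> c; case: x => a /= /andP[_].
by move=> /forallP/(_ i)/forallP/(_ j)/forallP/(_ k)/forallP/(_ l); rewrite c => /eqP.
Qed.

Lemma trop_eq (x y : trop n R) : x =1 y -> x = y.
Proof. by move=> h; apply: val_inj; apply/ffunP. Qed.

End Trop.

Lemma ler_sum_nat1 (F : nat -> int) P Q s : (P <= s < Q)%N ->
  (forall t, (P <= t < Q)%N -> 0 <= F t) -> F s <= \sum_(P <= t < Q) F t.
Proof.
move=> hs F0; rewrite (bigD1_seq s) ?mem_index_iota ?iota_uniq //= lerDl.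
rewrite big_seq_cond; apply: sumr_ge0 => t /andP[]; rewrite mem_index_iota => ht _.
exact: F0.
Qed.

Section Differences.
Variable n : nat.
Local Notation N := n.+3.
Local Notation vx := (vx n).
Implicit Types (i j k l p q : vertex n) (y : vset n -> int).

Definition tropical y := forall i j k l, cw i j k l ->
  y [set i; k] + y [set j; l] =
  Num.max (y [set i; j] + y [set k; l]) (y [set i; l] + y [set j; k]).

Definition wpos y := forall p q, is_diagonal [set p; q] -> 0 <= IA_exponent y p q.

Lemma IA_exponentS y p q : IA_exponent y (p + 1) (q + 1) =
  y [set p; q] + y [set p + 1; q + 1] - y [set p + 1; q] - y [set p; q + 1].
Proof. by rewrite /IA_exponent !addrK [[set q; p]]finset.setUC. Qed.

Lemma IA_exponentC y p q : IA_exponent y p q = IA_exponent y q p.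
Proof.
rewrite /IA_exponent (finset.setUC [set q] [set p]) (finset.setUC [set q - 1] [set p - 1]).
by rewrite (finset.setUC [set q] [set p - 1]) (finset.setUC [set q - 1] [set p]); ring.
Qed.

Lemma IA_exponentB (a b : vset n -> int) p q :
  IA_exponent (fun d => a d - b d) p q = IA_exponent a p q - IA_exponent b p q.
Proof. by rewrite /IA_exponent; ring. Qed.

Lemma IA_exponent_sum (m : nat) (a : 'I_m -> vset n -> int) p q :
  IA_exponent (fun d => \sum_(i < m) a i d) p q = \sum_(i < m) IA_exponent (a i) p q.
Proof. by rewrite /IA_exponent -big_split -!sumrB; apply: eq_bigr. Qed.

Lemma rect_sum y P Q R S : (P <= Q)%N -> (R <= S)%N ->
  \sum_(P <= s < Q) \sum_(R <= t < S) IA_exponent y (vx s.+1) (vx t.+1) =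
  y [set vx Q; vx S] + y [set vx P; vx R] - y [set vx P; vx S] - y [set vx Q; vx R].
Proof.
move=> PQ RS.
pose g s t := y [set vx s; vx t].
have -> : \sum_(P <= s < Q) \sum_(R <= t < S) IA_exponent y (vx s.+1) (vx t.+1)
  = \sum_(P <= s < Q) ((g s.+1 S - g s.+1 R) - (g s S - g s R)).
  apply: eq_bigr => s _; rewrite -(telescope_sumr (g s.+1)) // -(telescope_sumr (g s)) //.
  rewrite -sumrB; apply: eq_bigr => t _; rewrite !vxS IA_exponentS -!vxS /g; ring.
by rewrite (telescope_sumr (fun s => g s S - g s R)) // /g; lia.
Qed.

Lemma rect_ge y P Q R S s t : wpos y -> (P <= Q < R)%N -> (R <= S < P + N)%N ->
  (P < s <= Q)%N -> (R < t <= S)%N ->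
  IA_exponent y (vx s) (vx t) <=
  y [set vx Q; vx S] + y [set vx P; vx R] - y [set vx P; vx S] - y [set vx Q; vx R].
Proof.
move=> w0 h1 h2 hs ht; rewrite -rect_sum; try lia.
have hw s' t' : (P <= s' < Q)%N -> (R <= t' < S)%N ->
  0 <= IA_exponent y (vx s'.+1) (vx t'.+1).
  by move=> *; apply/w0/diagonal_vx; lia.
have Es : s = s.-1.+1 by lia.
have Et : t = t.-1.+1 by lia.
rewrite {1}Es {1}Et.
apply: (le_trans (y := \sum_(R <= t' < S) IA_exponent y (vx s.-1.+1) (vx t'.+1))).
  apply: (ler_sum_nat1 (F := fun t' => IA_exponent y (vx s.-1.+1) (vx t'.+1))); first by lia.
  by move=> *; apply: hw; lia.
apply: (ler_sum_nat1 (F := fun s' => \sum_(R <= t' < S) IA_exponent y (vx s'.+1) (vx t'.+1))).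
  by lia.
move=> s' hs'; rewrite big_nat_cond; apply: sumr_ge0 => t' /andP[ht' _].
exact: hw.
Qed.

(** What remains of the tropical Pluecker equation when the second differences w are
    known only to be nonnegative on the diagonals: the defect
    f_ik + f_jl - f_ij - f_kl is the sum of w over the pairs joining the arc
    (j, k] to the arc (l, i], so it dominates each w in that rectangle. *)
Lemma wpos_ge y P Q R S s t s' t' : wpos y -> (P < Q < R)%N -> (R < S < P + N)%N ->
  (P < s <= Q)%N -> (R < t <= S)%N -> (Q < s' <= R)%N -> (S < t' <= P + N)%N ->
  y [set vx P; vx Q] + y [set vx R; vx S] + IA_exponent y (vx s') (vx t')
    <= y [set vx P; vx R] + y [set vx Q; vx S] /\
  y [set vx P; vx S] + y [set vx Q; vx R] + IA_exponent y (vx s) (vx t)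
    <= y [set vx P; vx R] + y [set vx Q; vx S].
Proof.
move=> w0 h1 h2 hs ht hs' ht'; split.
  have := @rect_ge y Q R S (P + N)%N s' t' w0.
  rewrite vxDN (finset.setUC [set vx R] [set vx P]) (finset.setUC [set vx Q] [set vx P]).
  by move=> H; have := H ltac:(lia) ltac:(lia) hs' ht'; lia.
by have := @rect_ge y P Q R S s t w0 ltac:(lia) ltac:(lia) hs ht; lia.
Qed.

Lemma wpos_cw y i j k l : wpos y -> cw i j k l ->
  (y [set i; j] + y [set k; l] + Num.max 0 (IA_exponent y i k) <= y [set i; k] + y [set j; l]) /\
  (y [set i; l] + y [set j; k] + Num.max 0 (IA_exponent y j l) <= y [set i; k] + y [set j; l]).
Proof.
move=> w0 c; have e1 := w0 _ _ (cw_diagonal c).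
have e2 : 0 <= IA_exponent y j l by apply/w0/(@cw_diagonal _ j k l i); rewrite -cw_rot.
rewrite !max_r //; case/cw_lift: c e1 e2 => P [Q] [R] [S] [h1 h2 -> -> [-> ->]] _ _.
have := @wpos_ge y P Q R S Q S R (P + N)%N w0 h1 h2.
rewrite vxDN (IA_exponentC y (vx R)) => H.
by case: (H ltac:(lia) ltac:(lia) ltac:(lia) ltac:(lia)); split; lia.
Qed.

Lemma tropical_wpos y : tropical y -> wpos y.
Proof.
move=> ty p q dpq.
have : is_diagonal [set p - 1; q - 1].
  move: dpq; rewrite !is_diagonal_pair.
  by rewrite (inj_eq (addIr _)) (addrAC p) (addrAC q) !(inj_eq (addIr _)).
move/diagonal_cw/ty; rewrite !subrK /IA_exponent => E.
rewrite (finset.setUC [set q - 1] [set p - 1]) E -addrA -opprD subr_ge0.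
by rewrite le_max addrC lexx orbT.
Qed.

Lemma tropical_noncrossing y i j k l : tropical y -> cw i j k l ->
  0 < IA_exponent y i k -> 0 < IA_exponent y j l -> False.
Proof.
move=> ty c; have [] := wpos_cw (tropical_wpos ty) c; have := ty _ _ _ _ c; lia.
Qed.

(** If both Pluecker defects were positive, each would contain a positive w in its
    rectangle, and the two diagonals found in this way would cross. *)
Lemma noncrossing_tropical y : wpos y ->
  (forall i j k l, cw i j k l -> 0 < IA_exponent y i k -> 0 < IA_exponent y j l -> False) ->
  tropical y.
Proof.
move=> w0 nc i j k l /cw_lift[P] [Q] [R] [S] [h1 h2 -> -> [-> ->]].
have g := @wpos_ge y P Q R S _ _ _ _ w0 h1 h2.
have E1 := @rect_sum y P Q R S ltac:(lia) ltac:(lia).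
have E2 := @rect_sum y Q R S (P + N)%N ltac:(lia) ltac:(lia).
rewrite vxDN (finset.setUC [set vx R] [set vx P]) (finset.setUC [set vx Q] [set vx P]) in E2.
have [] := g Q S R (P + N)%N ltac:(lia) ltac:(lia) ltac:(lia) ltac:(lia).
have : 0 <= IA_exponent y (vx Q) (vx S) by apply/w0/diagonal_vx; lia.
have : 0 <= IA_exponent y (vx R) (vx (P + N)) by apply/w0/diagonal_vx; lia.
move=> n1 n2 i1 i2.
case: (lerP (y [set vx P; vx R] + y [set vx Q; vx S])
            (y [set vx P; vx S] + y [set vx Q; vx R])) => lt1; first by lia.
case: (lerP (y [set vx P; vx R] + y [set vx Q; vx S])
            (y [set vx P; vx Q] + y [set vx R; vx S])) => lt2; first by lia.
have [s [t [hs ht st]]] : exists s t, [/\ (P < s <= Q)%N, (R < t <= S)%N &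
    0 < IA_exponent y (vx s) (vx t)].
  apply/not_existsP => H; suff : \sum_(P <= s < Q) \sum_(R <= t < S)
    IA_exponent y (vx s.+1) (vx t.+1) <= 0 by lia.
  rewrite big_nat; apply: sumr_le0 => s hs; rewrite big_nat; apply: sumr_le0 => t ht.
  rewrite leNgt; apply/negP => h; apply: (H s.+1); exists t.+1; split=> //; lia.
have [s' [t' [hs' ht' st']]] : exists s t, [/\ (Q < s <= R)%N, (S < t <= P + N)%N &
    0 < IA_exponent y (vx s) (vx t)].
  apply/not_existsP => H; suff : \sum_(Q <= s < R) \sum_(S <= t < P + N)
    IA_exponent y (vx s.+1) (vx t.+1) <= 0 by lia.
  rewrite big_nat; apply: sumr_le0 => s0 hs0; rewrite big_nat; apply: sumr_le0 => t0 ht0.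
  rewrite leNgt; apply/negP => h; apply: (H s0.+1); exists t0.+1; split=> //; lia.
exfalso; apply: (nc (vx s) (vx s') (vx t) (vx t')) => //.
by apply: cw_vx; lia.
Qed.

End Differences.

(** * Integral tropical points and their second differences *)

Section Order.
Variable n : nat.
Local Notation N := n.+3.
Local Notation vx := (vx n).
Implicit Types (i j k l p q : vertex n) (y f : vset n -> int).

Definition diag_supported y := forall d, ~~ is_diagonal d -> y d = 0.

Lemma nondiag_loop p : ~~ is_diagonal [set p; p].
Proof. by rewrite is_diagonal_pair eqxx. Qed.

Lemma nondiag_edge p : ~~ is_diagonal [set p; p + 1].
Proof. by rewrite is_diagonal_pair eqxx andbF. Qed.

Lemma nondiag_edgeV p : ~~ is_diagonal [set p + 1; p].
Proof. by rewrite finset.setUC nondiag_edge. Qed.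

Lemma diag_supportedE y : diag_supported y ->
  ((forall p, (y [set p; p] = 0)%R) * (forall p, (y [set p; p + 1] = 0)%R) *
   (forall p, (y [set p + 1; p] = 0)%R) * (forall p, (y [set p - 1; p] = 0)%R) *
   (forall p, (y [set p; p - 1] = 0)%R))%type.
Proof.
move=> y0; have e p : y [set p - 1; p] = 0.
  by rewrite y0 //; have := nondiag_edge (p - 1); rewrite subrK.
split; [split; [split; [split|]|]|] => p; rewrite ?e //;
  try by rewrite y0 ?nondiag_loop ?nondiag_edge ?nondiag_edgeV.
by rewrite finset.setUC.
Qed.

Lemma mk_trop y : diag_supported y -> tropical y ->
  exists x : trop n int, forall d, x d = y d.
Proof.
move=> y0 ty; have h : is_trop [ffun d => y d].
  apply/andP; split.
    by apply/forallP => d; apply/implyP => /y0; rewrite ffunE => ->.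
  apply/forallP => i; apply/forallP => j; apply/forallP => k; apply/forallP => l.
  by apply/implyP => c; rewrite !ffunE ty.
by exists (Trop h) => d; rewrite /= ffunE.
Qed.

Lemma trop_tropical (x : trop n int) : tropical x.
Proof. by move=> i j k l; apply: trop_plucker. Qed.

Lemma trop_supported (x : trop n int) : diag_supported x.
Proof. exact: trop_nondiag. Qed.

Lemma sum_IA_exponent y p : \sum_q IA_exponent y p q = 0.
Proof.
have shift (g : vertex n -> int) : \sum_q g (q - 1) = \sum_q g q.
  by rewrite [RHS](reindex_inj (addIr (-1 : vertex n))).
rewrite /IA_exponent !sumrB big_split /=.
rewrite (shift (fun q => y [set q; p - 1])) (shift (fun q => y [set p; q])).
have -> : \sum_q y [set q; p - 1] = \sum_q y [set p - 1; q].
  by apply: eq_bigr => q _; rewrite finset.setUC.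
by rewrite addrK subrr.
Qed.

Lemma IA_exponent_loop y p : diag_supported y -> IA_exponent y p p = 0.
Proof.
by move=> y0; rewrite /IA_exponent !(diag_supportedE y0).
Qed.

Lemma IA_exponent_edge y p : diag_supported y ->
  IA_exponent y p (p + 1) = - y [set p - 1; p + 1].
Proof.
by move=> y0; rewrite /IA_exponent addrK !(diag_supportedE y0); ring.
Qed.

Lemma IA_exponent_diag y p q : diag_supported y -> tropical y ->
  is_diagonal [set p; q] ->
  IA_exponent y p q = Num.max 0 (- (y [set p; q - 1] + y [set p - 1; q])).
Proof.
move=> y0 ty dpq.
have : is_diagonal [set p - 1; q - 1].
  move: dpq; rewrite !is_diagonal_pair.
  by rewrite (inj_eq (addIr _)) (addrAC p) (addrAC q) !(inj_eq (addIr _)).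
move/diagonal_cw/ty; rewrite !subrK.
rewrite !(diag_supportedE y0) /IA_exponent (finset.setUC [set q - 1] [set p - 1]) => ->.
by rewrite addr0; case: (lerP 0 _) => ?; case: (lerP 0 _) => ? *; lra.
Qed.

(** On the rectangle formed by two complementary arcs the second differences add up
    to twice the value at the chord between them. *)
Lemma IA_exponent_inj x y : diag_supported x -> diag_supported y ->
  (forall p q, IA_exponent x p q = IA_exponent y p q) ->
  forall p q, x [set p; q] = y [set p; q].
Proof.
move=> x0 y0 E p q.
have [Q /andP[h1 h2] ->] := vx_window p q; rewrite -(vx_ord p).
have := @rect_sum n x p Q Q (p + N)%N h1 (ltnW h2).
under eq_bigr do under eq_bigr do rewrite E.
rewrite rect_sum // ?(ltnW h2) // vxDN.
rewrite !(x0 _ (nondiag_loop _)) !(y0 _ (nondiag_loop _)) !subr0.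
rewrite (finset.setUC [set vx Q]); lra.
Qed.

(** The exponents of the diagonals are antitone functions of the tropical point, and
    so are those of the edges. As the exponents at each vertex add up to 0, those of
    two comparable points must all coincide. *)
Lemma trop_le_eq (x y : trop n int) :
  (forall d, is_diagonal d -> x d <= y d) -> x = y.
Proof.
move=> le_xy.
have [x0 y0] := (trop_supported x, trop_supported y).
have le d : x d <= y d by case: (boolP (is_diagonal d)) => [/le_xy|/[dup] /x0 -> /y0 ->].
have leIA p q : IA_exponent y p q <= IA_exponent x p q.
  case: (boolP (is_diagonal [set p; q])) => [dpq|].
    rewrite !IA_exponent_diag //; try exact: trop_tropical.
    have := le [set p; q - 1]; have := le [set p - 1; q].
    by move=> ? ?; rewrite ge_max !le_max lexx /=; apply/orP; right; lra.
  rewrite is_diagonal_pair; case: (eqVneq p q) => [<-|_] /=; first by rewrite !IA_exponent_loop.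
  case: (eqVneq q (p + 1)) => [->|_] /=; first by rewrite !IA_exponent_edge // lerN2.
  case: (eqVneq p (q + 1)) => [->|//] _.
  by rewrite IA_exponentC [X in _ <= X]IA_exponentC !IA_exponent_edge // lerN2.
have eqIA p q : IA_exponent x p q = IA_exponent y p q.
  apply/eqP; rewrite -subr_eq0; apply/eqP.
  apply: (@psumr_eq0P _ _ xpredT (fun q => IA_exponent x p q - IA_exponent y p q)) => //.
    by move=> q' _; rewrite subr_ge0.
  by rewrite sumrB !sum_IA_exponent subrr.
apply: trop_eq => d; case: (boolP (is_diagonal d)) => [|/[dup] /x0 -> /y0 -> //].
move=> /is_diagonal_card/card2_pair[p [q [_ ->]]].
exact: IA_exponent_inj.
Qed.

(** Summation by parts: the second difference is self-adjoint up to a rotation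
    of the polygon by one step. *)
Lemma IA_exponent_adjoint y f :
  \sum_p \sum_q IA_exponent y p q * f [set p; q] =
  \sum_p \sum_q y [set p; q] * IA_exponent f (p + 1) (q + 1).
Proof.
have r1 (g : vertex n -> int) : \sum_p g p = \sum_p g (p + 1).
  by rewrite (reindex_inj (addIr (1 : vertex n))).
pose S4 (g1 g2 g3 g4 : vertex n -> vertex n -> int) :=
  (\sum_p \sum_q g1 p q) + (\sum_p \sum_q g2 p q)
   - (\sum_p \sum_q g3 p q) - (\sum_p \sum_q g4 p q).
have S4E g1 g2 g3 g4 : S4 g1 g2 g3 g4 =
    \sum_p \sum_q (g1 p q + g2 p q - g3 p q - g4 p q).
  rewrite /S4 -big_split -!sumrB; apply: eq_bigr => p _.
  by rewrite -big_split -!sumrB.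
transitivity (S4 (fun p q => y [set q - 1; p - 1] * f [set p; q])
                 (fun p q => y [set p; q] * f [set p; q])
                 (fun p q => y [set p; q - 1] * f [set p; q])
                 (fun p q => y [set p - 1; q] * f [set p; q])).
  by rewrite S4E; apply: eq_bigr => p _; apply: eq_bigr => q _; rewrite /IA_exponent; ring.
transitivity (S4 (fun p q => y [set p; q] * f [set p + 1; q + 1])
                 (fun p q => y [set p; q] * f [set p; q])
                 (fun p q => y [set p; q] * f [set p; q + 1])
                 (fun p q => y [set p; q] * f [set p + 1; q])).
  rewrite /S4; congr (_ + _ - _ - _).
  - rewrite r1; apply: eq_bigr => p _; rewrite r1; apply: eq_bigr => q _.
    by rewrite !addrK finset.setUC.
  - by apply: eq_bigr => p _; rewrite r1; apply: eq_bigr => q _; rewrite addrK.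
  - by rewrite r1; apply: eq_bigr => p _; rewrite addrK.
rewrite S4E; apply: eq_bigr => p _; apply: eq_bigr => q _.
by rewrite IA_exponentS; ring.
Qed.

End Order.

(** * Functions on pairs of vertices *)

Section SymFun.
Variable n : nat.
Local Notation N := n.+3.
Local Notation vx := (vx n).
Implicit Types (p q u v : vertex n) (y : vset n -> int).

Definition sym_fun (g : vertex n -> vertex n -> int) (d : vset n) : int :=
  if enum d is [:: p; q] then g p q else 0.

Lemma sym_fun_pair g p q : (forall p q, g p q = g q p) -> p != q ->
  sym_fun g [set p; q] = g p q.
Proof.
move=> gC; rewrite neq_ltn /sym_fun => /orP[h|h]; first by rewrite enum_pair.
by rewrite finset.setUC enum_pair // gC.
Qed.

Lemma sym_fun_loop g p : sym_fun g [set p; p] = 0.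
Proof. by rewrite finset.setUid /sym_fun enum_set1. Qed.

Lemma sym_fun_neq0 g d : sym_fun g d != 0 -> exists p q, [/\ d = [set p; q], (p < q)%N & g p q != 0].
Proof.
rewrite /sym_fun; have := sorted_enum_vset d.
case E: (enum d) => [|p [|q [|r s]]]; rewrite ?eqxx //= andbT => pq gpq.
exists p, q; split=> //; apply/setP => z; rewrite -mem_enum E !inE.
by [].
Qed.

Definition arc (P Q : nat) p : int := \sum_(P <= t < Q) (p == vx t)%:Z.

(** The indicator of the chords that join the arc [P, Q) to the arc [R, S). *)
Definition chi (P Q R S : nat) : vset n -> int :=
  sym_fun (fun p q => arc P Q p * arc R S q + arc P Q q * arc R S p).

Lemma arcB P Q p : (P <= Q)%N -> arc P Q p - arc P Q (p - 1) = (p == vx P)%:Z - (p == vx Q)%:Z.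
Proof.
move=> PQ; have := telescope_sumr (fun t => - (p == vx t)%:Z) PQ.
rewrite opprK addrC => <-; rewrite /arc -sumrB; apply: eq_bigr => t _.
by rewrite vxS subr_eq opprK addrC.
Qed.

Lemma arcE P Q U : (P < U + N)%N -> (Q <= U + N)%N -> (U < P + N)%N ->
  arc P Q (vx U) = (P <= U < Q)%N%:Z.
Proof.
move=> h1 h2 h3; rewrite /arc big_nat.
have E t : (P <= t < Q)%N -> (vx U == vx t) = (U == t).
  move=> ht; apply/eqP/eqP => [|-> //]; apply: vx_inj; lia.
under eq_bigr => t ht do rewrite E //.
rewrite -big_nat; case: (boolP (P <= U < Q)%N) => hU; last first.
  rewrite big_nat big1 // => t ht; case: eqP => // e; subst.
  by rewrite ht in hU.
rewrite (bigD1_seq U) ?mem_index_iota ?iota_uniq //= eqxx big1 ?addr0 // => t.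
by rewrite eq_sym => /negPf ->.
Qed.

Variables P Q R S : nat.
Hypotheses (PQR : (P < Q < R)%N) (RSP : (R < S < P + N)%N).

Lemma chi_pair p q : chi P Q R S [set p; q] = arc P Q p * arc R S q + arc P Q q * arc R S p.
Proof.
case: (eqVneq p q) => [<-|pq]; last by rewrite /chi sym_fun_pair // => u v; ring.
rewrite /chi sym_fun_loop; have [U hU ->] := vx_window P p.
by rewrite !arcE; lia.
Qed.

Lemma chi_vx U V : (P <= U < P + N)%N -> (P <= V < P + N)%N ->
  chi P Q R S [set vx U; vx V] =
  ((P <= U < Q) && (R <= V < S) || (P <= V < Q) && (R <= U < S))%N%:Z.
Proof.
move=> hU hV; by rewrite chi_pair !arcE; lia.
Qed.

Lemma chi_neq0 d : chi P Q R S d != 0 -> exists U V,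
  [/\ (P <= U < Q)%N, (R <= V < S)%N, d = [set vx U; vx V] & chi P Q R S d = 1].
Proof.
move=> c0; have [p [q [dE _ _]]] := sym_fun_neq0 c0.
move: c0; have [U hU pE] := vx_window P p; have [V hV qE] := vx_window P q.
rewrite dE pE qE chi_vx //; case: (boolP (_ || _)) => [/orP[]/andP[h1 h2] _|_]; last by rewrite eqxx.
  by exists U, V.
by exists V, U; rewrite finset.setUC.
Qed.

Lemma chi_ge0 d : 0 <= chi P Q R S d.
Proof.
by case: (eqVneq (chi P Q R S d) 0) => [-> //|/chi_neq0[U [V [_ _ _ ->]]]].
Qed.

Lemma chi_supported : diag_supported (chi P Q R S).
Proof.
move=> d; apply: contraNeq => /chi_neq0[U [V [h1 h2 -> _]]].
by apply: diagonal_vx; lia.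
Qed.

Definition at_pair u v p q : int := ([set p; q] == [set u; v])%:Z.

Lemma at_pairE u v p q : u != v ->
  at_pair u v p q = (p == u)%:Z * (q == v)%:Z + (p == v)%:Z * (q == u)%:Z.
Proof.
move=> uv; rewrite /at_pair; case: (boolP ([set p; q] == [set u; v])) => [/set2_eq|].
  by case=> -[<- <-]; rewrite !eqxx ?(eq_sym v) (negPf uv).
have [->|_] := eqVneq p u.
  by rewrite (negPf uv) mul0r addr0; have [->|] := eqVneq q v; rewrite ?eqxx.
have [->|_] := eqVneq p v; last by rewrite !mul0r.
by rewrite mul0r; have [->|] := eqVneq q u; rewrite // finset.setUC eqxx.
Qed.

(** The difference of the indicator of the arc [P, Q) lives at P and at Q, so the mixed
    second difference of chi lives at the four segments joining P, Q to R, S: it trades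
    the pair of segments PS, QR for the crossing pair PR, QS. *)
Lemma IA_exponent_chi p q : IA_exponent (chi P Q R S) p q =
  at_pair (vx P) (vx R) p q + at_pair (vx Q) (vx S) p q
  - at_pair (vx P) (vx S) p q - at_pair (vx Q) (vx R) p q.
Proof.
have D A B : (A < B < A + N)%N -> vx A != vx B by move=> h; apply/eqP => /vx_inj; lia.
rewrite !at_pairE ?D //; try lia.
have E1 := fun p => @arcB P Q p ltac:(lia); have E2 := fun p => @arcB R S p ltac:(lia).
rewrite /IA_exponent !chi_pair.
transitivity ((arc P Q p - arc P Q (p - 1)) * (arc R S q - arc R S (q - 1)) +
  (arc P Q q - arc P Q (q - 1)) * (arc R S p - arc R S (p - 1))); first by ring.
by rewrite !E1 !E2; ring.
Qed.

End SymFun.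

(** * The skein expansion *)

Section Skein.
Variable n : nat.
Local Notation N := n.+3.
Local Notation vx := (vx n).
Implicit Types (p q u v : vertex n) (a b y : vset n -> int).

Definition exp_monomial a : QAt n :=
  \prod_(p : vertex n) \prod_(q : vertex n | (p < q)%N)
    Atvar [set p; q] ^ IA_exponent a p q.

Lemma exp_monomialE (l : trop n int) : IA_monomial l = exp_monomial l.
Proof. by []. Qed.

Lemma eq_exp_monomial a b : (forall p q, IA_exponent a p q = IA_exponent b p q) ->
  exp_monomial a = exp_monomial b.
Proof. by move=> E; apply: eq_bigr => p _; apply: eq_bigr => q _; rewrite E. Qed.

Definition pair_prod (e : vertex n -> vertex n -> int) : QAt n :=
  \prod_(p : vertex n) \prod_(q : vertex n | (p < q)%N) Atvar [set p; q] ^ e p q.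

Lemma pair_prodD e f : pair_prod (fun p q => e p q + f p q) = pair_prod e * pair_prod f.
Proof.
rewrite -big_split; apply: eq_bigr => p _; rewrite -big_split; apply: eq_bigr => q _.
by rewrite expfzDr ?At_neq0.
Qed.

Lemma pair_prodN e : pair_prod (fun p q => - e p q) = (pair_prod e)^-1.
Proof.
rewrite -prodfV; apply: eq_bigr => p _; rewrite -prodfV; apply: eq_bigr => q _.
by rewrite invr_expz.
Qed.

Lemma pair_prod_at u v : u != v -> pair_prod (at_pair u v) = Atvar [set u; v].
Proof.
wlog uv : u v / (u < v)%N.
  move=> H uv; case: (ltngtP u v) => h; first exact: H.
    rewrite finset.setUC -H // 1?eq_sym //.
    by apply: eq_bigr => p _; apply: eq_bigr => q _; rewrite /at_pair (finset.setUC [set u]).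
  by case/eqP: uv; apply: val_inj.
move=> _; rewrite /pair_prod (bigD1 u) //= (bigD1 v) //= /at_pair eqxx expr1z.
rewrite [X in _ * X * _]big1 ?[X in _ * X]big1 ?mulr1 // => [p pu|q /andP[uq qv]].
  rewrite big1 // => q pq; case: eqP => [/eqP/set2_eq[[e _]|[e1 e2]]|//].
    by rewrite e eqxx in pu.
  by rewrite -e1 -e2 ltnNge (ltnW uv) in pq.
case: eqP => [/eqP/set2_eq[[_ e]|[e _]]|//]; first by rewrite e eqxx in qv.
by rewrite e ltnn in uq.
Qed.

Lemma exp_monomialB a b : exp_monomial (fun d => a d - b d) = exp_monomial a / exp_monomial b.
Proof.
transitivity (pair_prod (fun p q => IA_exponent a p q + - IA_exponent b p q)).
  by apply: eq_bigr => p _; apply: eq_bigr => q _; rewrite IA_exponentB.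
by rewrite pair_prodD pair_prodN.
Qed.

Lemma exp_monomial_sum (m : nat) (a : 'I_m -> vset n -> int) :
  exp_monomial (fun d => \sum_(i < m) a i d) = \prod_(i < m) exp_monomial (a i).
Proof.
rewrite /exp_monomial exchange_big /=; apply: eq_bigr => p _.
rewrite exchange_big /=; apply: eq_bigr => q _.
rewrite IA_exponent_sum; move: (At_neq0 [set p; q]).
move: (Atvar _) => A A0; elim/big_rec2: _ => [|i x z _ <-]; first by rewrite expr0z.
by rewrite expfzDr.
Qed.

Lemma exp_monomial_chi P Q R S : (P < Q < R)%N -> (R < S < P + N)%N ->
  exp_monomial (chi P Q R S) =
  Atvar [set vx P; vx R] * Atvar [set vx Q; vx S] /
  (Atvar [set vx P; vx S] * Atvar [set vx Q; vx R]).
Proof.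
move=> h1 h2.
have D A B : (A < B < A + N)%N -> vx A != vx B by move=> h; apply/eqP => /vx_inj; lia.
transitivity (pair_prod (fun p q => at_pair (vx P) (vx R) p q + at_pair (vx Q) (vx S) p q
  + (- at_pair (vx P) (vx S) p q + - at_pair (vx Q) (vx R) p q))).
  by apply: eq_bigr => p _; apply: eq_bigr => q _; rewrite IA_exponent_chi //; congr (_ ^ _); ring.
rewrite !pair_prodD !pair_prodN !pair_prod_at ?D //; try lia.
by rewrite invfM.
Qed.

(** After division by the left hand side this is the Pluecker relation, divided by
    A_PR A_QS. *)
Lemma exp_monomial_skein a P Q R S : (P < Q < R)%N -> (R < S < P + N)%N ->
  exp_monomial a = exp_monomial (fun d => a d - chi P Q R S d) +
                   exp_monomial (fun d => a d - chi Q R S (P + N) d).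
Proof.
move=> h1 h2; rewrite !exp_monomialB !exp_monomial_chi //; try lia.
rewrite vxDN (finset.setUC [set vx R]) (finset.setUC [set vx Q] [set vx P]).
rewrite !invf_div -mulrDr (mulrC (Atvar [set vx Q; vx S])) -mulrDl.
rewrite (addrC (_ * _)) -At_plucker ?divff ?mulr1 ?mulf_neq0 ?At_neq0 //.
exact: cw_vx.
Qed.

(** If x were below neither resolution, it would be equal to a on two crossing
    chords; but on these chords the sum of the values of a exceeds both of the sums
    that the Pluecker relation compares. *)
Lemma trop_le_resolution a (x : trop n int) P Q R S : wpos a ->
  (P < Q < R)%N -> (R < S < P + N)%N ->
  0 < IA_exponent a (vx P) (vx R) -> 0 < IA_exponent a (vx Q) (vx S) ->
  (forall d, x d <= a d) ->
  (forall d, x d <= a d - chi P Q R S d) \/ (forall d, x d <= a d - chi Q R S (P + N) d).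
Proof.
move=> w0 h1 h2 wPR wQS xa; apply: contrapT => /not_orP[/existsNP[d1 n1] /existsNP[d2 n2]].
have c1 : chi P Q R S d1 != 0 by apply: contra_notN n1 => /eqP ->; rewrite subr0.
have c2 : chi Q R S (P + N) d2 != 0 by apply: contra_notN n2 => /eqP ->; rewrite subr0.
have [U [V [hU hV dE1 e1]]] := chi_neq0 h1 h2 c1.
have [U' [V' [hU' hV' dE2 e2]]] := @chi_neq0 n Q R S (P + N)%N ltac:(lia) ltac:(lia) d2 c2.
have E1 : x d1 = a d1 by have := xa d1; move: n1; rewrite e1; lia.
have E2 : x d2 = a d2 by have := xa d2; move: n2; rewrite e2; lia.
have c : cw (vx U) (vx U') (vx V) (vx V') by apply: cw_vx; lia.
have E := trop_plucker x c; rewrite -dE1 -dE2 E1 E2 in E.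
have := @wpos_ge n a U U' V V' Q S R (P + N)%N w0.
rewrite vxDN (IA_exponentC _ (vx R)) -dE1 -dE2.
move=> /(_ ltac:(lia) ltac:(lia) ltac:(lia) ltac:(lia) ltac:(lia) ltac:(lia)) [i1 i2].
have := xa [set vx U; vx U']; have := xa [set vx V; vx V'].
have := xa [set vx U; vx V']; have := xa [set vx U'; vx V] => ? ? ? ?.
suff : a d1 + a d2 < a d1 + a d2 by rewrite ltxx.
by rewrite {1}E gt_max; apply/andP; split; lra.
Qed.

Lemma wpos_resolution a P Q R S : wpos a ->
  (P < Q < R)%N -> (R < S < P + N)%N ->
  0 < IA_exponent a (vx P) (vx R) -> 0 < IA_exponent a (vx Q) (vx S) ->
  wpos (fun d => a d - chi P Q R S d).
Proof.
move=> w0 h1 h2 wPR wQS p q dpq; have := w0 p q dpq.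
rewrite IA_exponentB IA_exponent_chi // /at_pair.
case: eqP => [/eqP E1|_].
  case: eqP => [/eqP E2|_].
    have := cw_vx h1 h2; move: (vx P) (vx Q) (vx R) (vx S) E1 E2 => i j k l.
    by move=> /set2_eq[]; case=> <- <- /set2_eq[]; case=> <- <-; rewrite /cw; lia.
  have -> : IA_exponent a p q = IA_exponent a (vx P) (vx R).
    by case/set2_eq: E1 => -[-> ->] //; rewrite IA_exponentC.
  by lia.
case: eqP => [/eqP E2|_]; last by lia.
have -> : IA_exponent a p q = IA_exponent a (vx Q) (vx S).
  by case/set2_eq: E2 => -[-> ->] //; rewrite IA_exponentC.
by lia.
Qed.

(** The sum and its rotation by one step add up to Pluecker defects of quadruples
    p, p + 1, q, q + 1, two of whose sides are edges. This bound makes the resolution of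
    crossings terminate. *)
Lemma sum_wpos_ge0 a : diag_supported a -> wpos a -> 0 <= \sum_p \sum_q a [set p; q].
Proof.
move=> a0 w0.
have E : \sum_p \sum_q a [set p; q] = \sum_p \sum_q a [set p + 1; q + 1].
  rewrite (reindex_inj (addIr (1 : vertex n))); apply: eq_bigr => p _ /=.
  by rewrite (reindex_inj (addIr (1 : vertex n))).
rewrite -(pmulr_rge0 _ (isT : 0 < 2 :> int)) mulr_natl mulr2n {2}E -big_split /=.
apply: sumr_ge0 => p _; rewrite -big_split; apply: sumr_ge0 => q _ /=.
case: (boolP (is_diagonal [set p; q])) => [/diagonal_cw c|].
  apply: le_trans (wpos_cw w0 c).1; rewrite !(diag_supportedE a0) !add0r.
  by rewrite le_max lexx.
rewrite is_diagonal_pair; case: (eqVneq p q) => [<-|_] /=; first by rewrite !(diag_supportedE a0).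
case: (eqVneq q (p + 1)) => [->|_] /=; first by rewrite !(diag_supportedE a0).
by case: (eqVneq p (q + 1)) => [->|//] _; rewrite !(diag_supportedE a0).
Qed.

(** Crossings are resolved as long as there are any. Each resolution decreases the
    function, so the nonnegative sum of its values serves as a measure, and no
    tropical point below the function is lost on the way. The sequence records the
    points with their multiplicities. *)
Theorem skein_expansion a : diag_supported a -> wpos a ->
  exists s : seq (trop n int), exp_monomial a = \sum_(x <- s) IA_monomial x /\
    forall x, x \in s <-> (forall d, x d <= a d).
Proof.
have [k] := ubnP (absz (\sum_p \sum_q a [set p; q])).
elim: k a => // k IH a lek a0 w0; have sum_ge0 := sum_wpos_ge0 a0 w0.
have [ta|nta] := EM (tropical a).
  have [y ya] := mk_trop a0 ta; exists [:: y]; split.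
    by rewrite big_seq1 exp_monomialE; apply: eq_exp_monomial => p q; rewrite /IA_exponent !ya.
  move=> x; rewrite inE; split=> [/eqP -> d|xa]; first by rewrite ya.
  by apply/eqP/trop_le_eq => d _; rewrite ya.
have : ~ (forall i j k l, cw i j k l -> 0 < IA_exponent a i k -> 0 < IA_exponent a j l -> False).
  by move/(noncrossing_tropical w0).
move=> /existsNP[i] /existsNP[j] /existsNP[k'] /existsNP[l] /not_implyP[].
move=> /cw_lift[P] [Q] [R] [S] [h1 h2 -> -> [-> ->]] /not_implyP[wPR] /not_implyP[wQS _].
have h3 : (Q < R < S)%N by lia.
have h4 : (S < P + N < Q + N)%N by lia.
have step P' Q' R' S' : (P' < Q' < R')%N -> (R' < S' < P' + N)%N ->
    wpos (fun d => a d - chi P' Q' R' S' d) ->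
    exists s : seq (trop n int), exp_monomial (fun d => a d - chi P' Q' R' S' d) =
      \sum_(x <- s) IA_monomial x /\
    forall x, x \in s <-> (forall d, x d <= a d - chi P' Q' R' S' d).
  move=> h1' h2' w0'; have a0' : diag_supported (fun d => a d - chi P' Q' R' S' d).
    by move=> d dd; rewrite a0 // (chi_supported h1' h2') // subrr.
  apply: IH => //; have := sum_wpos_ge0 a0' w0'.
  suff : 1 <= \sum_(p : vertex n) \sum_(q : vertex n) chi P' Q' R' S' [set p; q].
    have -> : \sum_p \sum_q (a [set p; q] - chi P' Q' R' S' [set p; q]) =
      \sum_p \sum_q a [set p; q] - \sum_(p : vertex n) \sum_(q : vertex n) chi P' Q' R' S' [set p; q].
      by rewrite -sumrB; apply: eq_bigr => p _; rewrite -sumrB.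
    by move: lek sum_ge0; move: (\sum_p _) (\sum_p _) => A C; lia.
  rewrite (bigD1 (vx P')) //= (bigD1 (vx R')) //= chi_vx //; try lia.
  have -> : ((P' <= P' < Q') && (R' <= R' < S') || (P' <= R' < Q') && (R' <= P' < S'))%N by lia.
  rewrite -addrA lerDl addr_ge0 // sumr_ge0 // => p _; first exact: chi_ge0.
  by apply: sumr_ge0 => q _; apply: chi_ge0.
have [|s1 [E1 H1]] := step P Q R S h1 h2; first exact: wpos_resolution.
have [|s2 [E2 H2]] := step Q R S (P + N)%N h3 h4.
  by apply: wpos_resolution => //; rewrite vxDN IA_exponentC.
exists (s1 ++ s2); split; first by rewrite big_cat (exp_monomial_skein a h1 h2) E1 E2.
move=> x; rewrite mem_cat; split.
  case/orP=> [/H1|/H2] le d; apply: (le_trans (le d)); rewrite gerBl; exact: chi_ge0.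
case/(trop_le_resolution w0 h1 h2 wPR wQS) => [/H1 ->|/H2 ->]; by rewrite ?orbT.
Qed.

End Skein.

(** * Exponential growth of rational functions *)

Lemma cross_mul (K : fieldType) (a b c d : K) : b != 0 -> d != 0 ->
  a / b = c / d -> a * d = c * b.
Proof. by move=> b0 d0 /eqP; rewrite eqr_div // => /eqP. Qed.

Section Growth.
Variable N : nat.
Local Notation "p %:F" := (@FracField.tofrac _ p).
Local Notation KF := {fraction {mpoly rat[N]}}.
Implicit Types (f g : KF) (r s : rat) (v w : int) (pt : 'I_N -> rat) (path : nat -> 'I_N -> rat).

(** Evaluation at a point is only partially defined on rational functions; the value
    may be read off any presentation whose denominator does not vanish there. *)
Definition evalsto pt f r : Prop := exists p q : {mpoly rat[N]},
  [/\ q.@[pt] != 0, f = p%:F / q%:F & r = p.@[pt] / q.@[pt]].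

Lemma evalsto_den pt (q : {mpoly rat[N]}) : q.@[pt] != 0 -> q%:F != 0.
Proof. by rewrite tofrac_eq0; apply: contraNneq => ->; rewrite meval0. Qed.

Lemma evalsto_uniq pt f r s : evalsto pt f r -> evalsto pt f s -> r = s.
Proof.
move=> [p [q [q0 -> ->]]] [p' [q' [q'0 E ->]]].
have E' := cross_mul (evalsto_den q0) (evalsto_den q'0) E.
rewrite -!tofracM in E'; move/eqP: E'; rewrite tofrac_eq => /eqP E'.
by apply/eqP; rewrite eqr_div // -!mevalM E'.
Qed.

Lemma evalsto_poly pt (p : {mpoly rat[N]}) : evalsto pt p%:F p.@[pt].
Proof. by exists p, 1; rewrite meval1 oner_neq0 tofrac1 !divr1. Qed.

Lemma evalsto1 pt : evalsto pt 1 1.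
Proof. by have := evalsto_poly pt 1; rewrite tofrac1 meval1. Qed.

Lemma evalsto0 pt : evalsto pt 0 0.
Proof. by have := evalsto_poly pt 0; rewrite tofrac0 meval0. Qed.

Lemma evalstoM pt f g r s : evalsto pt f r -> evalsto pt g s -> evalsto pt (f * g) (r * s).
Proof.
move=> [p [q [q0 -> ->]]] [p' [q' [q'0 -> ->]]]; exists (p * p'), (q * q').
split; first by rewrite mevalM mulf_neq0.
  by rewrite !tofracM mulf_div.
by rewrite !mevalM mulf_div.
Qed.

Lemma evalstoD pt f g r s : evalsto pt f r -> evalsto pt g s -> evalsto pt (f + g) (r + s).
Proof.
move=> [p [q [q0 -> ->]]] [p' [q' [q'0 -> ->]]]; exists (p * q' + p' * q), (q * q').
split; first by rewrite mevalM mulf_neq0.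
  by rewrite (addf_div _ _ (evalsto_den q0) (evalsto_den q'0)) tofracD !tofracM.
by rewrite mevalD !mevalM addf_div.
Qed.

Lemma evalstoV pt f r : r != 0 -> evalsto pt f r -> evalsto pt f^-1 r^-1.
Proof.
move=> r0 [p [q [q0 -> rE]]]; exists q, p; rewrite rE !invf_div; split=> //.
by apply: contraNneq r0 => E; rewrite rE E mul0r.
Qed.

Lemma evalsto_indet pt k (hk : (k < N)%N) : evalsto pt (indet N k) (pt (Ordinal hk)).
Proof.
by rewrite /indet insubT; have := evalsto_poly pt 'X_(Ordinal hk); rewrite mevalXU.
Qed.

Definition pow2 (k : nat) v : rat := 2 ^ (k%:Z * v).

Lemma pow2_gt0 k v : 0 < pow2 k v.
Proof. exact: exprz_gt0. Qed.

Lemma pow2D k v w : pow2 k (v + w) = pow2 k v * pow2 k w.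
Proof. by rewrite /pow2 mulrDr expfzDr. Qed.

Lemma pow2N k v : pow2 k (- v) = (pow2 k v)^-1.
Proof. by rewrite /pow2 mulrN invr_expz. Qed.

Lemma le_pow2 k v w : v <= w -> pow2 k v <= pow2 k w.
Proof. by move=> vw; rewrite /pow2 ler_weXz2l // ?ler1n // ler_wpM2l. Qed.

(** The function grows like 2^(k v) at the k-th point of the path: v is its tropical
    value in the direction of the path. *)
Definition growth path f v : Prop := exists2 C : rat, 0 < C & forall k, exists r,
  [/\ evalsto (path k) f r, pow2 k v <= C * r & r <= C * pow2 k v].

Lemma growth_uniq path f v w : growth path f v -> growth path f w -> v = w.
Proof.
wlog : v w / v < w.
  move=> H gv gw; case: (ltgtP v w) => //; first by move=> h; exact: H.
  by move=> h; symmetry; exact: H.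
move=> vw [C C0 gv] [D D0 gw]; exfalso.
pose k := Num.bound (C * D).
have : C * D < pow2 k 1.
  apply: lt_le_trans (archi_boundP _) _; first by rewrite ltW // mulr_gt0.
  rewrite /pow2 mulr1 -exprnP -natrX ler_nat ltnW // ltn_expl //.
apply/negP; rewrite -leNgt.
have [r [er h1 _]] := gw k; have [s [es _ h2]] := gv k.
rewrite -(evalsto_uniq er es) in h2.
have h3 : pow2 k w <= C * D * pow2 k v.
  by apply: (le_trans h1); rewrite [C * D]mulrC -mulrA ler_pM2l.
rewrite -(ler_pM2r (pow2_gt0 k v)) -pow2D; apply: le_trans h3.
by apply: le_pow2; rewrite addrC -ltzD1 ltrD2r.
Qed.

Lemma growth1 path : growth path 1 0.
Proof.
exists 1 => // k; exists 1; rewrite /pow2 mulr0 expr0z mulr1 lexx; split=> //.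
exact: evalsto1.
Qed.

Lemma growth_neq0 path f v : growth path f v -> f != 0.
Proof.
move=> [C C0 /(_ 0%N)[r [er h1 _]]]; apply/eqP => f0.
rewrite f0 in er; have := evalsto_uniq er (evalsto0 _) => r0.
by move: h1; rewrite r0 mulr0 leNgt pow2_gt0.
Qed.

Lemma growthM path f g v w : growth path f v -> growth path g w -> growth path (f * g) (v + w).
Proof.
move=> [C C0 gv] [D D0 gw]; exists (C * D); first exact: mulr_gt0.
move=> k; have [r [er r1 r2]] := gv k; have [s [es s1 s2]] := gw k.
have r0 : 0 < r by rewrite -(pmulr_rgt0 _ C0); apply: lt_le_trans r1; exact: pow2_gt0.
have s0 : 0 < s by rewrite -(pmulr_rgt0 _ D0); apply: lt_le_trans s1; exact: pow2_gt0.
exists (r * s); rewrite pow2D; split; first exact: evalstoM.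
  by rewrite mulrACA ler_pM // ltW // pow2_gt0.
by rewrite mulrACA ler_pM // ltW.
Qed.

Lemma growthV path f v : growth path f v -> growth path f^-1 (- v).
Proof.
move=> [C C0 gv]; exists C => // k; have [r [er r1 r2]] := gv k.
have r0 : 0 < r by rewrite -(pmulr_rgt0 _ C0); apply: lt_le_trans r1; exact: pow2_gt0.
exists r^-1; rewrite pow2N; split; first by apply: evalstoV => //; rewrite gt_eqF.
  by rewrite ler_pdivlMr // ler_pdivrMl ?pow2_gt0 // mulrC.
by rewrite ler_pdivlMr ?pow2_gt0 // ler_pdivrMl // mulrC.
Qed.

Lemma growthD path f g v w : growth path f v -> growth path g w ->
  growth path (f + g) (Num.max v w).
Proof.
move=> [C C0 gv] [D D0 gw]; exists (C + D); first exact: addr_gt0.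
move=> k; have [r [er r1 r2]] := gv k; have [s [es s1 s2]] := gw k.
have r0 : 0 < r by rewrite -(pmulr_rgt0 _ C0); apply: lt_le_trans r1; exact: pow2_gt0.
have s0 : 0 < s by rewrite -(pmulr_rgt0 _ D0); apply: lt_le_trans s1; exact: pow2_gt0.
have [Cr Cs Dr Ds] : [/\ 0 <= C * r, 0 <= C * s, 0 <= D * r & 0 <= D * s].
  by split; rewrite mulr_ge0 // ltW.
exists (r + s); split; first exact: evalstoD.
  by case: (leP v w) => _; lra.
rewrite mulrDl; apply: lerD.
  by apply: (le_trans r2); rewrite ler_pM2l // le_pow2 // le_max lexx.
by apply: (le_trans s2); rewrite ler_pM2l // le_pow2 // le_max lexx orbT.
Qed.

Lemma growth_eq path f v w : growth path f v -> v = w -> growth path f w.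
Proof. by move=> h <-. Qed.

Lemma growthX path f v (m : nat) : growth path f v -> growth path (f ^+ m) (m%:Z * v).
Proof.
move=> h; elim: m => [|m IH]; first by rewrite mul0r; exact: growth1.
by rewrite exprS; apply: growth_eq (growthM h IH) _; rewrite intS; ring.
Qed.

Lemma growthXz path f v (m : int) : growth path f v -> growth path (f ^ m) (m * v).
Proof.
move=> h; case: m => m; first exact: growthX.
by apply: growth_eq (growthV (growthX m.+1 h)) _; rewrite NegzE mulNr.
Qed.

Lemma growth_prod path (I : Type) (s : seq I) (P : pred I) (F : I -> KF) (e : I -> int) :
  (forall i, P i -> growth path (F i) (e i)) ->
  growth path (\prod_(i <- s | P i) F i) (\sum_(i <- s | P i) e i).
Proof.
move=> h; elim/big_rec2: _ => [|i y x Pi IH]; first exact: growth1.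
by apply: growthM => //; exact: h.
Qed.

Lemma growth_natmul path f v (c : nat) : (0 < c)%N -> growth path f v -> growth path (f *+ c) v.
Proof.
case: c => // c _ h; elim: c => [//|c IH]; rewrite mulrS.
by apply: growth_eq (growthD h IH) _; rewrite maxxx.
Qed.

(** No cancellation is possible in a sum of functions with positive coefficients, so
    it grows like its largest term. *)
Lemma growth_sum path (I : eqType) (s : seq I) (F : I -> KF) (c : I -> nat) (e : I -> int) :
  s != [::] -> (forall i, i \in s -> (0 < c i)%N) ->
  (forall i, i \in s -> growth path (F i) (e i)) ->
  exists v, [/\ growth path (\sum_(i <- s) F i *+ c i) v,
    exists2 i, i \in s & v = e i & forall i, i \in s -> e i <= v].
Proof.
elim: s => // i [|j s] IH _ c0 h.
  exists (e i); rewrite big_seq1; split.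
  - by apply: growth_natmul; [apply: c0 | apply: h]; rewrite inE.
  - by exists i; rewrite ?inE.
  - by move=> k; rewrite inE => /eqP ->.
have [||v [gv [k ks vE] le]] := IH isT.
- by move=> k ks; apply: c0; rewrite inE ks orbT.
- by move=> k ks; apply: h; rewrite inE ks orbT.
have gi : growth path (F i *+ c i) (e i).
  by apply: growth_natmul; [apply: c0 | apply: h]; rewrite inE eqxx.
exists (Num.max (e i) v); rewrite big_cons; split; first exact: growthD.
  by case: (leP (e i) v) => _; [exists k; rewrite // inE ks orbT | exists i; rewrite // inE eqxx].
move=> k'; rewrite inE le_max => /orP[/eqP ->|/le ->]; by rewrite ?lexx ?orbT.
Qed.

(** In fan coordinates A_ij is u_i u_j times a sum of positive terms, whose partial
    sums follow the tropical Pluecker relations of the quadruples 0, i, j, j + 1. *)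
Lemma growth_fan path (u v : nat -> KF) (X : nat -> nat -> int) (M : nat) :
  (forall j, (0 < j <= M)%N -> growth path (u j) (X 0%N j)) ->
  (forall j, (0 < j < M)%N -> growth path (v j) (X j j.+1)) ->
  (forall i j, (0 < i < j)%N -> (j < M)%N ->
     X 0%N j + X i j.+1 = Num.max (X 0%N i + X j j.+1) (X 0%N j.+1 + X i j)) ->
  forall i j, (i < j <= M)%N -> growth path (fan_pair u v i j) (X i j).
Proof.
move=> gu gv pl [|i] j /andP[ij jM]; first by apply: gu; lia.
rewrite /fan_pair.
suff : growth path (\sum_(i.+1 <= k < j) v k / (u k * u k.+1)) (X i.+1 j - X 0%N i.+1 - X 0%N j).
  move=> g; apply: growth_eq (growthM (growthM (gu i.+1 _) (gu j _)) g) _; try lia.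
have gt k : (0 < k < M)%N -> growth path (v k / (u k * u k.+1)) (X k k.+1 - X 0%N k - X 0%N k.+1).
  move=> hk; apply: growth_eq (growthM (gv k _) (growthV (growthM (gu k _) (gu k.+1 _)))) _; lia.
elim: j ij jM => // j IH ij jM; move: (ij); rewrite ltnS leq_eqVlt => /orP[/eqP e|lt_ij].
  by rewrite -e big_nat1; apply: gt; lia.
rewrite big_nat_recr //=; apply: growth_eq (growthD (IH lt_ij (ltnW jM)) (gt j _)) _; first lia.
have := pl i.+1 j lt_ij jM; rewrite !maxEle; do 2 case: ifP => ?; lia.
Qed.

End Growth.

(** * Linear independence of the monomials of tropical points *)

Section Independence.
Variable n : nat.
Local Notation N := n.+3.
Local Notation vx := (vx n).
Implicit Types (p q : vertex n) (l x y : trop n int).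

Lemma sum_pairs_sym (g : vertex n -> vertex n -> int) :
  (forall p q, g p q = g q p) -> (forall p, g p p = 0) ->
  \sum_p \sum_q g p q = (\sum_(p : vertex n) \sum_(q : vertex n | (p < q)%N) g p q) * 2.
Proof.
move=> gC g0.
transitivity (\sum_(p : vertex n) ((\sum_(q : vertex n | (p < q)%N) g p q) +
  \sum_(q : vertex n | (q < p)%N) g p q)).
  apply: eq_bigr => p _; rewrite (bigD1 p) //= g0 add0r.
  rewrite (bigID (fun q : vertex n => (p < q)%N)) /=.
  by congr (_ + _); apply: eq_bigl => q; rewrite -val_eqE /=; lia.
rewrite big_split /= [X in _ + X](exchange_big_dep xpredT) //= mulr_natr mulr2n.
by congr (_ + _); apply: eq_bigr => p _; apply: eq_bigr => q _.
Qed.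

(** The Pluecker relation for 0, i, j, j + 1 determines the value at i, j + 1 from
    values at 0 and the value at i, j. *)
Lemma trop_fan_eq x y : (forall q, x [set ord0; q] = y [set ord0; q]) -> x = y.
Proof.
move=> E.
have H j : (j < N)%N -> forall i, (i < j)%N -> x [set vx i; vx j] = y [set vx i; vx j].
  elim: j => // j IH hj [|i] hij.
    have -> : vx 0 = ord0 by apply: val_inj.
    exact: E.
  move: (hij); rewrite ltnS leq_eqVlt => /orP[/eqP <-|lt_ij].
    by rewrite (vxS n i.+1) (diag_supportedE (@trop_supported _ x)) (diag_supportedE (@trop_supported _ y)).
  have c : cw (vx 0) (vx i.+1) (vx j) (vx j.+1) by apply: cw_vx; lia.
  have := trop_plucker x c; have := trop_plucker y c.
  rewrite !IH //; try lia.
  have -> : vx 0 = ord0 by apply: val_inj.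
  rewrite !E (vxS n j) (diag_supportedE (@trop_supported _ x)) (diag_supportedE (@trop_supported _ y)) => <-.
  by move/addrI.
apply: trop_eq => d; case: (boolP (is_diagonal d)) => [|dd]; last by rewrite !trop_nondiag.
move=> /is_diagonal_card/card2_pair[p [q [pq ->]]].
by rewrite -(vx_ord p) -(vx_ord q) H.
Qed.

Section Weights.
Variable B : nat.

(** The exponents e_j of the edge variables along the path u_j = 1, v_j = 2^(k e_j).
    They do not decrease, so v_(j-1) sets the rate of growth of A_ij; their increments
    are the powers of B, so that the tropical value of IA(l) is a polynomial in B whose
    coefficients are the fan coordinates of l. *)
Definition staircase (j : nat) : int := \sum_(0 <= t < j.+1) (B%:Z ^+ t).

Lemma staircaseS j : staircase j.+1 = staircase j + B%:Z ^+ j.+1.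
Proof. by rewrite /staircase big_nat_recr. Qed.

Definition stair_pair (p q : nat) : int :=
  if (p == 0)%N || (q == 0)%N then 0 else staircase (maxn p q).-1.

Definition stair_fun : vset n -> int := sym_fun (fun p q => stair_pair p q).

Lemma stair_funE p q : p != q -> stair_fun [set p; q] = stair_pair p q.
Proof.
move=> pq; rewrite /stair_fun sym_fun_pair // => {p q pq} p q.
by rewrite /stair_pair orbC maxnC.
Qed.

Lemma stair_fun_diff p q : is_diagonal [set p; q] ->
  IA_exponent stair_fun (p + 1) (q + 1) =
  (p == ord0)%:Z * B%:Z ^+ q + (q == ord0)%:Z * B%:Z ^+ p.
Proof.
wlog pq : p q / (p < q)%N.
  move=> H; case: (ltngtP p q) => [|pq|/val_inj ->]; first exact: H.
    by rewrite finset.setUC => /(H _ _ pq); rewrite IA_exponentC => ->; rewrite addrC.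
  by move/negP: (nondiag_loop q).
rewrite is_diagonal_pair => /and3P[h1 h2 h3].
have c1 : (p.+1 < q)%N.
  rewrite ltn_neqAle pq andbT; apply: contra h2 => /eqP e.
  by apply/eqP/ord_inj; rewrite vertexS ifT //; have := ltn_ord q; lia.
have q0 : (q == ord0) = false by apply/negP => /eqP e; rewrite e in pq.
have p1 : p + 1 = p.+1 :> nat by rewrite vertexS ifT //; have := ltn_ord q; lia.
rewrite q0 mul0r addr0 IA_exponentS.
have n1 : p + 1 != q + 1 by rewrite (inj_eq (addIr _)).
have n2 : p + 1 != q by rewrite eq_sym.
rewrite !stair_funE // /stair_pair p1 vertexS.
have -> : (nat_of_ord q == 0)%N = false by rewrite -q0 -val_eqE.
rewrite -val_eqE /=.
case: ltnP => hq; last first.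
  have -> : (p == 0%N :> nat) = false.
    by apply: contraNF h3 => /eqP e; apply/eqP/ord_inj; rewrite vertexS ifF ?e //; lia.
  have [-> ->] : (maxn p q = q /\ maxn p.+1 q = q)%N by lia.
  by rewrite !orbT /=; ring.
have [-> -> -> ->] : [/\ maxn p q = q, maxn p.+1 q = q, maxn p q.+1 = q.+1 & maxn p.+1 q.+1 = q.+1]%N.
  by split; lia.
have -> : nat_of_ord q = q.-1.+1 by lia.
by rewrite /= staircaseS; case: (nat_of_ord p == 0%N) => /=; ring.
Qed.

Definition stair_weight l : int := \sum_q l [set ord0; q] * B%:Z ^+ q.

Lemma stair_weightE l :
  \sum_(p : vertex n) \sum_(q : vertex n | (p < q)%N)
    IA_exponent l p q * stair_fun [set p; q] = stair_weight l.
Proof.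
apply: (@mulIf _ 2) => //.
rewrite -sum_pairs_sym; last 2 first.
- by move=> p q; rewrite IA_exponentC finset.setUC.
- by move=> p; rewrite /stair_fun sym_fun_loop mulr0.
rewrite IA_exponent_adjoint.
have E p q : l [set p; q] * IA_exponent stair_fun (p + 1) (q + 1) =
  l [set p; q] * ((p == ord0)%:Z * B%:Z ^+ q) + l [set p; q] * ((q == ord0)%:Z * B%:Z ^+ p).
  case: (boolP (is_diagonal [set p; q])) => [/stair_fun_diff ->|dd]; first by rewrite mulrDr.
  by rewrite trop_nondiag // !mul0r.
under eq_bigr do under eq_bigr do rewrite E.
under eq_bigr do rewrite big_split /=.
rewrite big_split /= mulr_natr mulr2n; congr (_ + _).
  rewrite (bigD1 ord0) //= [X in _ + X]big1 ?addr0 => [|p /negPf ->].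
    by apply: eq_bigr => q _; rewrite mul1r.
  by apply: big1 => q _; rewrite mul0r mulr0.
apply: eq_bigr => p _; rewrite (bigD1 ord0) //= [X in _ + X]big1 ?addr0 => [|q /negPf ->].
  by rewrite mul1r finset.setUC.
by rewrite mul0r mulr0.
Qed.

Definition stair_path (k : nat) (i : 'I_(n.*2.+3)) : rat :=
  if (i < n.+2)%N then 1 else pow2 k (staircase (i - n.+1)).

Lemma growth_At p q : (p < q)%N -> growth stair_path (Atvar [set p; q]) (stair_fun [set p; q]).
Proof.
move=> pq; rewrite stair_funE; last by rewrite neq_ltn pq.
rewrite /Atvar fan_varE //.
apply: (@growth_fan _ stair_path _ _ stair_pair n.+2).
- move=> j hj; have hj' : (j.-1 < n.*2.+3)%N by lia.
  exists 1 => // k; exists 1; split; rewrite /stair_pair ?eqxx /pow2 ?mulr0 ?expr0z //.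
  have := evalsto_indet (stair_path k) hj'.
  by rewrite {2}/stair_path /= ifT //; lia.
- move=> j hj; have hj' : (n.+1 + j < n.*2.+3)%N by lia.
  exists 1 => // k; exists (pow2 k (staircase j)); rewrite mul1r /stair_pair.
  have -> : (maxn j j.+1).-1 = j by lia.
  have -> : (j == 0)%N = false by lia.
  split=> //; last by rewrite mul1r.
  have := evalsto_indet (stair_path k) hj'.
  rewrite {2}/stair_path /= ifF; last by lia.
  by rewrite addKn.
- move=> i j hij hj; rewrite /stair_pair /=.
  have -> : (i == 0)%N = false by lia.
  have -> : (j == 0)%N = false by lia.
  have [-> -> ->] : [/\ (maxn i j.+1).-1 = j.-1.+1, (maxn j j.+1).-1 = j.-1.+1 & (maxn i j).-1 = j.-1] by split; lia.
  rewrite !add0r max_l // staircaseS lerDl; exact: exprn_ge0.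
- by have := ltn_ord q; lia.
Qed.

Lemma growth_IA l : growth stair_path (IA_monomial l) (stair_weight l).
Proof.
rewrite -stair_weightE; apply: growth_prod => p _; apply: growth_prod => q pq.
by apply: growthXz; exact: growth_At.
Qed.

End Weights.

(** Distinct points give distinct polynomials in B, and a nonzero polynomial does not
    vanish at all natural numbers. *)
Lemma separating_base (s : seq (trop n int)) :
  exists B : nat, {in s &, injective (stair_weight B)}.
Proof.
pose P l : {poly int} := \poly_(q < N) l [set ord0; inord q].
pose Q := \prod_(x <- s) \prod_(y <- s | x != y) (P x - P y).
have Q0 : Q != 0.
  rewrite prodf_seq_neq0; apply/allP => x _; rewrite prodf_seq_neq0; apply/allP => y _.
  apply/implyP => xy; rewrite subr_eq0.
  apply: contra xy => /eqP E; apply/eqP/trop_fan_eq => q.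
  have := congr1 (fun p : {poly int} => p`_q) E.
  by rewrite !coef_poly ltn_ord inord_val.
have [B rB] : exists B : nat, ~~ root Q B%:Z.
  apply: contrapT => /forallNP H.
  have all_root : all (root Q) [seq k%:Z | k <- iota 0 (size Q)].
    by apply/allP => _ /mapP[k _ ->]; have /negP := H k; rewrite negbK.
  have := max_poly_roots Q0 all_root; rewrite map_inj_uniq ?iota_uniq; last by move=> a b [].
  by move=> /(_ isT); rewrite size_map size_iota ltnn.
have PE l : (P l).[B%:Z] = stair_weight B l.
  rewrite /P horner_poly; apply: eq_bigr => q _; by rewrite inord_val.
exists B => x y xs ys; rewrite -!PE => E; apply: contraNeq rB => xy.
rewrite /root /Q horner_prod (big_rem x xs) /= horner_prod (big_rem y ys) /= xy.
by rewrite !hornerE E subrr !mul0r.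
Qed.

(** Two different nonnegative combinations with disjoint supports grow at different
    rates along a path on which the monomials have different rates of growth. *)
Lemma IA_monomial_free (s : seq (trop n int)) (c : trop n int -> int) :
  uniq s -> \sum_(l <- s) IA_monomial l *~ c l = 0 -> forall l, l \in s -> c l = 0.
Proof.
move=> us E l ls; apply: contrapT => /eqP cl0.
have [B injB] := separating_base s.
pose sp := [seq l <- s | 0 < c l]; pose sn := [seq l <- s | c l < 0].
have half (t : seq (trop n int)) : {subset t <= s} -> t != [::] -> (forall l, l \in t -> c l != 0) ->
    exists2 x, x \in t & growth (stair_path B) (\sum_(l <- t) IA_monomial l *+ absz (c l)) (stair_weight B x).
  move=> ts t0 ct; have [||v [gv [x xt vE] _]] := @growth_sum _ (stair_path B) _ t (@IA_monomial n)
    (fun l => absz (c l)) (stair_weight B) t0.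
  - by move=> x /ct; rewrite -absz_gt0.
  - by move=> x _; exact: growth_IA.
  by exists x => //; rewrite -vE.
have Epn : \sum_(l <- sp) IA_monomial l *+ absz (c l) = \sum_(l <- sn) IA_monomial l *+ absz (c l).
  apply/eqP; rewrite -subr_eq0; apply/eqP; rewrite -[RHS]E !big_filter.
  rewrite big_mkcond [X in _ - X]big_mkcond -sumrB; apply: eq_bigr => x _.
  rewrite /=; case: (ltrgtP 0 (c x)) => [h|h|<-]; last by rewrite mulr0z subr0.
    by rewrite subr0 -{2}(gtz0_abs h).
  by rewrite sub0r -{2}(opprK (c x)) -(ltz0_abs h) mulrNz.
have cp x : x \in sp -> (x \in s) /\ 0 < c x by rewrite mem_filter => /andP[].
have cn x : x \in sn -> (x \in s) /\ c x < 0 by rewrite mem_filter => /andP[].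
have hp := half sp (fun x h => (cp x h).1); have hn := half sn (fun x h => (cn x h).1).
have kp x : x \in sp -> c x != 0 by move/cp => [_ h]; rewrite gt_eqF.
have kn x : x \in sn -> c x != 0 by move/cn => [_ h]; rewrite lt_eqF.
have [ep|np] := eqVneq sp [::].
  have [en|nn] := eqVneq sn [::].
    case: (ltrgtP (c l) 0) cl0 => // h _.
      by suff : l \in sn; [rewrite en | rewrite mem_filter h].
    by suff : l \in sp; [rewrite ep | rewrite mem_filter h].
  have [x _ /growth_neq0] := hn nn kn.
  by rewrite -Epn ep big_nil eqxx.
have [x xs gx] := hp np kp.
have [en|nn] := eqVneq sn [::]; first by move/growth_neq0: gx; rewrite Epn en big_nil eqxx.
have [y ys gy] := hn nn kn; rewrite Epn in gx.
have [[xs' cx] [ys' cy]] := (cp _ xs, cn _ ys).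
have xy := injB _ _ xs' ys' (growth_uniq gx gy).
by move: cx; rewrite xy ltNge ltW.
Qed.

Lemma canonical_expansion_unique (f : QX n) c c' :
  canonical_expansion f c -> canonical_expansion f c' -> c = c'.
Proof.
move=> Ec Ec'; apply/fsfunP => x.
pose s := undup (finsupp c ++ finsupp c').
have widen (c0 : {fsfun trop n int -> int with 0}) : {subset finsupp c0 <= s} ->
    \sum_(l <- finsupp c0) IA l *~ c0 l = \sum_(l <- s) IA l *~ c0 l.
  move=> sub; rewrite [RHS](bigID (fun l => l \in finsupp c0)) /= [X in _ + X]big1 ?addr0; last first.
    by move=> y; rewrite memNfinsupp => /eqP ->; rewrite mulr0z.
  rewrite -[RHS]big_filter; apply: perm_big; apply: uniq_perm.
  - exact: fset_uniq.
  - by rewrite filter_uniq // undup_uniq.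
  - by move=> y; rewrite mem_filter; case: (boolP (y \in _)) => //= /sub ->.
have Z : \sum_(l <- s) IA l *~ (c l - c' l) = 0.
  under eq_bigr do rewrite mulrzBr.
  rewrite sumrB -!widen -?Ec -?Ec' ?subrr // => y; rewrite mem_undup mem_cat => ->; by rewrite ?orbT.
have [xs|] := boolP (x \in s); last first.
  by rewrite mem_undup mem_cat negb_or !memNfinsupp => /andP[/eqP -> /eqP ->].
have Z' : \sum_(l <- s) IA_monomial l *~ (c l - c' l) = 0.
  have := congr1 (val : QX n -> QAt n) Z; rewrite rmorph_sum rmorph0 => E0.
  rewrite -[RHS]E0; by apply: eq_bigr => y _; rewrite rmorphMz.
have H := @IA_monomial_free s (fun l => c l - c' l) (undup_uniq _) Z'.
by apply/eqP; rewrite -subr_eq0; apply/eqP; exact: H.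
Qed.

End Independence.

Section Expansion.
Variables (n m : nat) (l : 'I_m -> trop n int).

Definition sum_trop (d : vset n) : int := \sum_(i < m) l i d.

Lemma sum_trop_supported : diag_supported sum_trop.
Proof. by move=> d dd; apply: big1 => i _; exact: trop_nondiag. Qed.

Lemma sum_trop_wpos : wpos sum_trop.
Proof.
move=> p q dpq; rewrite IA_exponent_sum; apply: sumr_ge0 => i _.
by apply: tropical_wpos => //; exact: trop_tropical.
Qed.

Lemma canonical_expansion_exists : exists2 c : {fsfun trop n int -> int with 0},
  canonical_expansion (\prod_(i < m) IA (l i)) c &
  forall x, c x != 0 <-> (forall d, is_diagonal d -> x d <= sum_trop d).
Proof.
have [s [Es Hs]] := skein_expansion sum_trop_supported sum_trop_wpos.
pose c : {fsfun trop n int -> int with 0} :=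
  [fsfun x in seq_fset tt s => (count_mem x s)%:Z].
have cE x : c x = (count_mem x s)%:Z.
  rewrite fsfunE seq_fsetE; case: ifP => // /negbT; rewrite -has_pred1 has_count.
  by rewrite -eqn0Ngt => /eqP ->.
exists c; last first.
  move=> x; have -> : (c x != 0) = (x \in s).
    by rewrite cE -has_pred1 has_count lt0n.
  rewrite Hs; split=> h d; first by move=> _; exact: h.
  case: (boolP (is_diagonal d)) => [/h //|dd].
  by rewrite trop_nondiag // sum_trop_supported.
apply: val_inj; rewrite rmorph_prod rmorph_sum.
transitivity (exp_monomial sum_trop).
  by rewrite exp_monomial_sum; apply: eq_bigr.
rewrite Es -big_undup_iterop_count.
transitivity (\sum_(x <- undup s) IA_monomial x *+ count_mem x s).
  by apply: eq_bigr => x _; elim: (count_mem x s) => [|[|k] IHk] //; rewrite mulrS -IHk.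
rewrite [RHS](perm_big (undup s)); last first.
  apply: uniq_perm; rewrite ?undup_uniq ?fset_uniq // => x.
  by rewrite mem_undup mem_finsupp cE -[x \in s]has_pred1 has_count lt0n.
by apply: eq_bigr => x _; rewrite rmorphMz cE.
Qed.

End Expansion.

(** * Induction on the number of crossings with a triangulation *)

Section SegmentInduction.
Variable n : nat.
Implicit Types (i j k l u v p q : vertex n) (d e : vset n) (T : {set vset n}).

Lemma crossing_pairP i k e :
  reflect (exists u v, cw i u k v /\ e = [set u; v]) (crossing [set i; k] e).
Proof.
apply: (iffP (crossingP _ _)) => [[i' [j' [k' [l' [c /eqP/set2_eq E ->]]]]]|[u [v [c ->]]]].
  case: E => -[E1 E2]; subst; first by exists j', l'.
  by exists l', j'; rewrite finset.setUC -2!cw_rot in c *; split=> //; rewrite cw_rot cw_rot.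
by exists i, u, k, v.
Qed.

(** A diagonal that crosses a side of a quadrilateral i, j, k, l but not its diagonal jl
    crosses its diagonal ik. *)
Lemma cw_side_left i j k l u v : cw i j k l -> cw i u j v -> cw i u k v || cw u j v l.
Proof. by case/or4P=> /andP[h1 h2]; case/or4P=> /andP[h3 h4]; rewrite /cw; lia. Qed.

Lemma cw_side_right i j k l u v : cw i j k l -> cw i u l v -> cw i u k v || cw u l v j.
Proof. by case/or4P=> /andP[h1 h2]; case/or4P=> /andP[h3 h4]; rewrite /cw; lia. Qed.

Lemma crossing_shared i j k : crossing [set i; j] [set j; k] = false.
Proof.
apply/negbTE/negP => /crossing_pairP[u [v [c /eqP/set2_eq E]]].
by move: c; rewrite /cw; case: E => -[-> ->]; lia.
Qed.

(** Every segment is reached from the segments crossing no element of T by solving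
    Pluecker relations for one diagonal of a quadrilateral whose other diagonal is
    in T: the sides of the quadrilateral cross fewer elements of T. *)
Lemma seg_ind T (Pr : vset n -> Prop) :
  (forall d e, d \in T -> e \in T -> ~~ crossing d e) ->
  (forall p q, p != q -> (forall e, e \in T -> ~~ crossing [set p; q] e) -> Pr [set p; q]) ->
  (forall i j k l, cw i j k l -> [set j; l] \in T -> Pr [set i; j] -> Pr [set k; l] ->
     Pr [set i; l] -> Pr [set j; k] -> Pr [set i; k]) ->
  forall p q, p != q -> Pr [set p; q].
Proof.
move=> nc base step p q.
pose X d := [set e in T | crossing d e].
have [m] := ubnP #|X [set p; q]|; elim: m p q => // m IH i k lem ik.
have [none|] := EM (forall e, e \in T -> ~~ crossing [set i; k] e); first exact: base.
case/existsNP => e /not_implyP[eT /negP]; rewrite negbK => /crossing_pairP[j [l [c eE]]].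
have sub d : ~~ crossing d e -> (forall f, f \in T -> crossing d f -> crossing [set i; k] f) ->
    (#|X d| < m)%N.
  move=> nde h; rewrite -ltnS; apply: leq_trans lem; rewrite ltnS; apply: proper_card.
  apply/fintype.properP; split.
    by apply/fintype.subsetP => f; rewrite !inE => /andP[fT /(h f fT) ->]; rewrite fT.
  exists e; rewrite !inE eT ?(negPf nde) //=; apply/crossing_pairP; by exists j, l.
have left (a b c0 d : vertex n) : cw a b c0 d -> [set a; c0] = [set i; k] -> [set b; d] = e ->
    (#|X [set a; b]| < m)%N.
  move=> c1 E1 E2; apply: sub; first by rewrite -E2 crossing_shared.
  move=> f fT /crossing_pairP[u [v [cf fE]]]; rewrite -E1.
  case/orP: (cw_side_left c1 cf) => c2; first by apply/crossing_pairP; exists u, v.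
  have := nc _ _ fT eT; rewrite crossingC -E2; case/negP; apply/crossing_pairP.
  by exists v, u; rewrite -2!cw_rot fE finset.setUC; split=> //; rewrite cw_rot.
have right (a b c0 d : vertex n) : cw a b c0 d -> [set a; c0] = [set i; k] -> [set b; d] = e ->
    (#|X [set a; d]| < m)%N.
  move=> c1 E1 E2; apply: sub; first by rewrite -E2 (finset.setUC [set b]) crossing_shared.
  move=> f fT /crossing_pairP[u [v [cf fE]]]; rewrite -E1.
  case/orP: (cw_side_right c1 cf) => c2; first by apply/crossing_pairP; exists u, v.
  have := nc _ _ fT eT; rewrite crossingC -E2; case/negP; apply/crossing_pairP.
  exists u, v; split=> //; move: c2; rewrite /cw; lia.
have c' : cw k l i j by rewrite 2!cw_rot.
have neq (a b c0 d : vertex n) : cw a b c0 d -> (a != b) && (a != d).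
  by rewrite /cw -!val_eqE /=; lia.
apply: (step i j k l) => //; first by rewrite -eE.
- by apply: IH; [apply: (left _ _ _ _ c) | case/andP: (neq _ _ _ _ c)].
- apply: IH; last by case/andP: (neq _ _ _ _ c').
  by apply: (left _ _ _ _ c'); rewrite ?eE finset.setUC.
- by apply: IH; [apply: (right _ _ _ _ c) | case/andP: (neq _ _ _ _ c)].
- rewrite finset.setUC; apply: IH; last by case/andP: (neq _ _ _ _ c').
  by apply: (right _ _ _ _ c'); rewrite ?eE finset.setUC.
Qed.

Lemma partial_triangulationP T : reflect
  ((forall d, d \in T -> is_diagonal d) /\ (forall d e, d \in T -> e \in T -> ~~ crossing d e))
  (partial_triangulation T).
Proof.
apply: (iffP andP) => -[h1 h2]; split.
- by move=> d dT; move/forallP: h1 => /(_ d); rewrite dT.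
- move=> d e dT eT; move/forallP: h2 => /(_ d); rewrite dT => /forallP/(_ e).
  by rewrite eT.
- by apply/forallP => d; apply/implyP; exact: h1.
- apply/forallP => d; apply/implyP => dT; apply/forallP => e; apply/implyP.
  exact: h2.
Qed.

Lemma compatibleP T d : reflect
  [/\ is_diagonal d, d \notin T & forall e, e \in T -> ~~ crossing d e] (d \in compatible T).
Proof.
rewrite inE; apply: (iffP and3P) => -[h1 h2 h3]; split=> //.
  by move=> e eT; move/forallP: h3 => /(_ e); rewrite eT.
by apply/forallP => e; apply/implyP; exact: h3.
Qed.

End SegmentInduction.

(** * Stasheff polytopes *)

Section StasheffPolytope.
Variables (n : nat) (R : realType) (c : vset n -> R).
Hypothesis c_nondiag : forall d, ~~ is_diagonal d -> c d = 0.
Hypothesis c_plucker : forall i j k l : vertex n, cw i j k l ->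
  c [set i; j] + c [set k; l] <= c [set i; k] + c [set j; l] /\
  c [set i; l] + c [set j; k] <= c [set i; k] + c [set j; l].

(** On a face, the bound x_d <= c_d spreads from the diagonals that cross no element
    of T to all the others: in the Pluecker relation the crossing element of T is an
    equality, and c satisfies the relation as an inequality. *)
Lemma stasheff_plucker : stasheff c.
Proof.
move=> T1 T2 /partial_triangulationP[d1 nc1] /partial_triangulationP[d2 nc2] T12 x [eq2 le2].
have le p q : p != q -> x [set p; q] <= c [set p; q].
  apply: (@seg_ind n T2 (fun d => x d <= c d) nc2) => [{}p {}q pq ncr|i j k l cw1 jlT ij kl il jk].
    case: (boolP (is_diagonal [set p; q])) => dpq; last by rewrite trop_nondiag // c_nondiag.
    case: (boolP ([set p; q] \in T2)) => inT; first by rewrite eq2.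
    by apply: le2; apply/compatibleP.
  have := trop_plucker x cw1; have [] := c_plucker cw1; rewrite (eq2 _ jlT) => h1 h2 E.
  rewrite -(lerD2r (c [set j; l])) E ge_max; apply/andP; split; lra.
split=> [d dT|d /compatibleP[dd _ _]].
  by apply: eq2; exact: (fintype.subsetP T12).
by case/is_diagonal_card/card2_pair: dd => p [q [pq ->]]; apply: le; rewrite neq_ltn pq.
Qed.

End StasheffPolytope.

Lemma stasheff_sum_trop (R : realType) (n m : nat) (l : 'I_m -> trop n int) :
  integral_stasheff_polytope R
    [set x : trop n int | forall d, is_diagonal d -> x d <= sum_trop l d]%classic.
Proof.
exists (fun d => (sum_trop l d)%:~R).
  apply: stasheff_plucker => [d dd|i j k k' c]; first by rewrite sum_trop_supported.
  have [h1 h2] := wpos_cw (sum_trop_wpos l) c; rewrite -!intrD !ler_int.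
  by split; [apply: le_trans h1 | apply: le_trans h2]; rewrite lerDl le_max lexx.
apply/seteqP; split=> x /= h.
  split=> d; first by rewrite inE.
  by move/compatibleP => [dd _ _]; rewrite ffunE ler_int; exact: h.
move=> d dd; have : d \in compatible finset.set0.
  by apply/compatibleP; split=> // [|e]; rewrite inE.
by move/(h.2 d); rewrite ffunE ler_int.
Qed.

(** * Tropical functions with prescribed values on a triangulation *)

Lemma ord_neq (k : nat) (i j : 'I_k) : (i != j) = ((i < j) || (j < i))%N.
Proof. by rewrite -val_eqE neq_ltn. Qed.

Lemma ex_max_ord (k : nat) (Pr : pred 'I_k) (i0 : 'I_k) : Pr i0 ->
  exists2 i, Pr i & forall j, Pr j -> (j <= i)%N.
Proof. by move=> h; case: (arg_maxnP (@nat_of_ord k) h) => i hi hm; exists i. Qed.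

Lemma ex_min_ord (k : nat) (Pr : pred 'I_k) (i0 : 'I_k) : Pr i0 ->
  exists2 i, Pr i & forall j, Pr j -> (i <= j)%N.
Proof. by move=> h; case: (arg_minnP (@nat_of_ord k) h) => i hi hm; exists i. Qed.

Section FanExtension.
Variable n : nat.
Local Notation N := n.+3.
Local Notation vx := (vx n).
Implicit Types (i j k l : vertex n).

Fixpoint range_max (s : nat -> int) (i d : nat) : int :=
  if d is d'.+1 then Num.max (range_max s i d') (s (i + d)%N) else s i.

Lemma range_max_cat (s : nat -> int) (i d e : nat) :
  range_max s i (d + e).+1 = Num.max (range_max s i d) (range_max s (i + d).+1 e).
Proof.
elim: e => [|e IH]; first by rewrite addn0 /= addnS.
rewrite addnS -[LHS]/(Num.max (range_max s i (d + e).+1) (s (i + (d + e).+2)%N)) IH /= -maxA; congr (Num.max _ (Num.max _ (s _))); lia.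
Qed.

Variable v : vset n -> int.

Let U (j : nat) : int := v [set vx 0; vx j].
Let sl (k : nat) : int := v [set vx k; vx k.+1] - U k - U k.+1.

(** The tropical form of the expression of A_ij in the coordinates of the fan. *)
Definition fan_trop (i j : nat) : int :=
  if i is 0 then U j else U i + U j + range_max sl i (j - i)%N.-1.

Definition fan_trop_fun : vset n -> int :=
  sym_fun (fun p q => fan_trop (minn p q) (maxn p q)).

Lemma fan_trop_funE i j : (i < j)%N -> fan_trop_fun [set i; j] = fan_trop i j.
Proof.
move=> ij; rewrite /fan_trop_fun sym_fun_pair => [|p q|]; last by rewrite ord_neq ij.
  by congr fan_trop; lia.
by rewrite minnC maxnC.
Qed.

Lemma fan_trop_plucker (i j k l : nat) : (i < j < k)%N -> (k < l)%N ->
  fan_trop i k + fan_trop j l =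
  Num.max (fan_trop i j + fan_trop k l) (fan_trop i l + fan_trop j k).
Proof.
have split_max a b c : (a < b < c)%N -> range_max sl a (c - a)%N.-1 =
    Num.max (range_max sl a (b - a)%N.-1) (range_max sl b (c - b)%N.-1).
  move=> h; have -> : ((c - a).-1 = ((b - a).-1 + (c - b).-1).+1)%N by lia.
  by rewrite range_max_cat; congr (Num.max _ (range_max _ _ _)); lia.
case: j => [|j]; first by lia. case: k => [|k]; first by lia. case: l => [|l]; first by lia.
move=> h1 h2; case: i h1 => [|i] h1; rewrite /fan_trop.
  rewrite (@split_max j.+1 k.+1 l.+1); last by lia.
  by move: (range_max _ _ _) (range_max _ _ _) => A B; lia.
rewrite (@split_max j.+1 k.+1 l.+1) ?(@split_max i.+1 j.+1 k.+1) ?(@split_max i.+1 j.+1 l.+1)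
  ?(@split_max j.+1 k.+1 l.+1); lia.
Qed.

Lemma fan_trop_tropical : tropical fan_trop_fun.
Proof.
have sorted_case i j k l : (i < j < k)%N -> (k < l)%N ->
  fan_trop_fun [set i; k] + fan_trop_fun [set j; l] =
  Num.max (fan_trop_fun [set i; j] + fan_trop_fun [set k; l])
          (fan_trop_fun [set i; l] + fan_trop_fun [set j; k]).
  by move=> h1 h2; rewrite !fan_trop_funE; try lia; exact: fan_trop_plucker.
have C (a b : vertex n) : [set a; b] = [set b; a] by rewrite finset.setUC.
move=> i j k l /or4P[]/andP[h1 h2]; first exact: sorted_case.
- have := sorted_case _ _ _ _ h1 h2; rewrite (C k i) (C l i) (C j i) => E.
  by rewrite addrC E maxC; congr (Num.max _ _); ring.
- have := sorted_case _ _ _ _ h1 h2; rewrite (C k i) (C l i) (C l j) (C k j) => ->.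
  by congr (Num.max _ _); ring.
- have := sorted_case _ _ _ _ h1 h2; rewrite (C l i) (C l j) (C l k) => E.
  by rewrite addrC E maxC; congr (Num.max _ _); ring.
Qed.

Lemma fan_trop_fan i : (0 < i)%N -> fan_trop_fun [set ord0; i] = v [set ord0; i].
Proof.
move=> i0; rewrite fan_trop_funE // /fan_trop /U vx_ord.
by have -> : vx 0 = ord0 by apply: val_inj.
Qed.

Lemma fan_trop_edge i j : (0 < i)%N -> nat_of_ord j = i.+1 ->
  fan_trop_fun [set i; j] = v [set i; j].
Proof.
move=> i0 ji; rewrite fan_trop_funE ?ji // /fan_trop.
have -> : ((i.+1 - i).-1 = 0)%N by lia.
have <- : vx i.+1 = j by rewrite -ji vx_ord.
case: (nat_of_ord i) i0 (vx_ord i) => // i' _ <-.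
by rewrite /= /sl; lra.
Qed.

End FanExtension.

Ltac ord_lia :=
  repeat match goal with
  | H : ?P |- _ => lazymatch P with
     | is_true (leq _ _) => fail
     | is_true (andb (leq _ _) _) => fail
     | @eq nat _ _ => fail
     | or _ _ => fail
     | and _ _ => fail
     | _ => clear H
     end
  end; lia.

Section Complete.
Variable n : nat.
Local Notation N := n.+3.
Local Notation vx := (vx n).
Implicit Types (i j k l p q u : vertex n) (T : {set vset n}).

Lemma edge_pair p q : p != q -> is_edge [set p; q] = ~~ is_diagonal [set p; q].
Proof. by move=> pq; rewrite /is_diagonal cards2 pq /= negbK. Qed.

Lemma mem_tilde T p q : p != q ->
  ([set p; q] \in tilde T) = ([set p; q] \in T) || ~~ is_diagonal [set p; q].
Proof. by move=> pq; rewrite !inE edge_pair. Qed.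

Lemma crossing_diagonal d e : @crossing n d e -> is_diagonal d /\ is_diagonal e.
Proof.
move=> /crossingP[i [j [k [l [c -> ->]]]]]; split; first exact: cw_diagonal c.
by apply: (@cw_diagonal _ j k l i); rewrite -cw_rot.
Qed.

Lemma crossing_irrefl d : ~~ @crossing n d d.
Proof.
apply/negP => /crossingP[i [j [k [l [c -> /eqP/set2_eq E]]]]].
by move: c; rewrite /cw; case: E => -[-> ->]; lia.
Qed.

Lemma completeP T : reflect (partial_triangulation T /\
    forall d, is_diagonal d -> (forall e, e \in T -> ~~ crossing d e) -> d \in T)
  (complete_triangulation T).
Proof.
rewrite /complete_triangulation; apply: (iffP maxsetP) => -[pT mT]; split=> //.
  move=> d dd ncd; have /partial_triangulationP[dT ncT] := pT.
  rewrite -(mT (d |: T)) ?finset.subsetUr ?setU11 //; apply/partial_triangulationP; split.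
    by move=> e; rewrite !inE => /orP[/eqP ->|/dT].
  have ndd := crossing_irrefl d.
  move=> e f; rewrite !finset.in_setU1 => /orP[/eqP ->|eT] /orP[/eqP ->|fT].
  - exact: ndd.
  - exact: ncd.
  - by rewrite crossingC; exact: ncd.
  - exact: ncT.
move=> B pB TB; apply/eqP; rewrite finset.eqEsubset TB andbT; apply/fintype.subsetP => d dB.
have /partial_triangulationP[dB' ncB] := pB; apply: mT; first exact: dB'.
by move=> e eT; apply: ncB => //; exact: (fintype.subsetP TB).
Qed.

Lemma complete_extension T : partial_triangulation T ->
  exists2 D, complete_triangulation D & T \subset D.
Proof. by move/maxset_exists => [D mD TD]; exists D. Qed.

Lemma complete_exists : exists T, @complete_triangulation n T.
Proof.
have [|D cD _] := @complete_extension finset.set0; last by exists D.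
by apply/partial_triangulationP; split=> [d|d e]; rewrite inE.
Qed.

Section Flip.
Variable T : {set vset n}.
Hypothesis cT : complete_triangulation T.

Lemma complete_diag d : d \in T -> is_diagonal d.
Proof. by case/completeP: cT => /partial_triangulationP[h _] _; exact: h. Qed.

Lemma cw_split i j k l : (i < k)%N -> cw i j k l ->
  (i < j < k)%N /\ ((k < l)%N \/ (l < i)%N).
Proof. by rewrite /cw; lia. Qed.

Lemma cw_neq i j k l : cw i j k l -> i != k /\ j != l.
Proof.
by move=> c; split; rewrite ord_neq; move: c; rewrite /cw; lia.
Qed.

Lemma tilde_noncrossing i j k l : cw i j k l ->
  [set i; k] \in tilde T -> [set j; l] \in tilde T -> False.
Proof.
move=> c; have c' : crossing [set i; k] [set j; l] by apply/crossingP; exists i, j, k, l.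
have [d1 d2] := crossing_diagonal c'.
case/completeP: cT => /partial_triangulationP[_ nc] _.
have [n1 n2] := cw_neq c.
by rewrite !mem_tilde // d1 d2 !orbF => h1 h2; move/negP: (nc _ _ h1 h2).
Qed.

Lemma mem_tilde_max p q : p != q ->
  (forall u w, cw p u q w -> [set u; w] \in T -> False) -> [set p; q] \in tilde T.
Proof.
move=> pq h; rewrite mem_tilde //; case: (boolP (is_diagonal _)) => dd; last by rewrite orbT.
case/completeP: cT => _ mT; rewrite mT // => e eT; apply/negP => /crossing_pairP[u [w [c eE]]].
by apply: (h u w c); rewrite -eE.
Qed.

Lemma edge_tilde p : [set p; p + 1] \in tilde T.
Proof. by rewrite !inE; apply/orP; right; apply/existsP; exists p. Qed.

Lemma edgeS_tilde i j : nat_of_ord j = i.+1 -> [set i; j] \in tilde T.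
Proof.
move=> e; have -> : j = i + 1 by apply: ord_inj; rewrite vertexS ifT //; have := ltn_ord j; lia.
exact: edge_tilde.
Qed.

(** If 0q is missing, the neighbours i < q < k of 0 that are closest to q are joined by a
    diagonal of T, and the triangle of T on the other side of ik supplies a
    quadrilateral in which ik can be flipped to a diagonal at 0. *)
Lemma flippable_quad q : q != ord0 -> [set ord0; q] \notin tilde T ->
  exists i j k, [/\ (0 < i < j)%N, (j < k)%N, [set i; k] \in T,
    [set ord0; i] \in tilde T /\ [set ord0; k] \in tilde T &
    [set i; j] \in tilde T /\ [set j; k] \in tilde T].
Proof.
move=> q0 nq; have q_gt0 : (0 < q)%N by rewrite lt0n.
have v1 : vx 1 = 1%N :> nat by rewrite vx_small.
have v2 : vx n.+2 = n.+2 :> nat by rewrite vx_small.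
have e1 : [set ord0; vx 1] \in tilde T by apply: edgeS_tilde; rewrite v1.
have e2 : [set ord0; vx n.+2] \in tilde T.
  have -> : ord0 = vx n.+2 + 1 by apply: ord_inj; rewrite vertexS v2 ltnn.
  by rewrite finset.setUC edge_tilde.
have q1 : (1 < q)%N.
  rewrite ltn_neqAle q_gt0 andbT; apply: contraNneq nq => e.
  by rewrite (_ : q = vx 1) //; apply: ord_inj; rewrite v1.
have q2 : (q < n.+2)%N.
  have := ltn_ord q; rewrite ltnS leq_eqVlt => /orP[/eqP e|//].
  by move: nq; rewrite (_ : q = vx n.+2) ?e2 //; apply: ord_inj; rewrite v2.
have [i /and3P[i0 iq ti] imax] : exists2 i : vertex n, [&& (0 < i)%N, (i < q)%N & [set ord0; i] \in tilde T] &
    forall i' : vertex n, [&& (0 < i')%N, (i' < q)%N & [set ord0; i'] \in tilde T] -> (i' <= i)%N.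
  have h1 : [&& (0 < vx 1)%N, (vx 1 < q)%N & [set ord0; vx 1] \in tilde T] by rewrite v1 e1 q1.
  exact: (@ex_max_ord _ (fun i' : vertex n => [&& (0 < i')%N, (i' < q)%N & [set ord0; i'] \in tilde T]) _ h1).
have [k /andP[qk tk] kmin] : exists2 k : vertex n, (q < k)%N && ([set ord0; k] \in tilde T) &
    forall k' : vertex n, (q < k')%N && ([set ord0; k'] \in tilde T) -> (k <= k')%N.
  have h1 : (q < vx n.+2)%N && ([set ord0; vx n.+2] \in tilde T) by rewrite v2 e2 q2.
  exact: (@ex_min_ord _ (fun k' : vertex n => (q < k')%N && ([set ord0; k'] \in tilde T)) _ h1).
have TT d : d \in T -> d \in tilde T by rewrite inE => ->.
have ikt : [set i; k] \in tilde T.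
  apply: mem_tilde_max => [|u w c uwT]; first by rewrite ord_neq (ltn_trans iq).
  have [hu hw] := cw_split (ltn_trans iq qk) c.
  have [w0|w0] := eqVneq w ord0.
    rewrite w0 finset.setUC in uwT; have tu := TT _ uwT.
    case: (ltngtP u q) => uq.
    - by have := imax u; rewrite tu uq (_ : (0 < u)%N) /=; ord_lia.
    - by have := kmin u; rewrite tu uq /=; ord_lia.
    - by move: nq; rewrite -(val_inj uq) tu.
  have w_gt0 : (0 < w)%N by rewrite lt0n.
  case: hw => hw.
    by apply: (@tilde_noncrossing ord0 u k w) => //; [rewrite /cw /=; ord_lia | exact: TT].
  apply: (@tilde_noncrossing ord0 w i u) => //; first by rewrite /cw /=; ord_lia.
  by rewrite finset.setUC; exact: TT.
have dlt (a b : vertex n) : (0 < a)%N -> (a.+1 < b)%N -> is_diagonal [set a; b].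
  move=> a0 ab; rewrite -(vx_ord a) -(vx_ord b); apply: diagonal_vx => //.
  by have := ltn_ord b; ord_lia.
have ikT : [set i; k] \in T.
  by move: ikt; rewrite mem_tilde ?dlt ?orbF //; try ord_lia; rewrite ord_neq; ord_lia.
have [j /and3P[ij jk tj] jmax] : exists2 j : vertex n, [&& (i < j)%N, (j < k)%N & [set i; j] \in tilde T] &
    forall j' : vertex n, [&& (i < j')%N, (j' < k)%N & [set i; j'] \in tilde T] -> (j' <= j)%N.
  have vi : vx i.+1 = i.+1 :> nat by rewrite vx_small //; have := ltn_ord q; ord_lia.
  have h1 : [&& (i < vx i.+1)%N, (vx i.+1 < k)%N & [set i; vx i.+1] \in tilde T].
    by rewrite vi edgeS_tilde // ltnSn; ord_lia.
  exact: (@ex_max_ord _ (fun j' : vertex n => [&& (i < j')%N, (j' < k)%N & [set i; j'] \in tilde T]) _ h1).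
exists i, j, k; split=> //; first by rewrite i0.
split=> //; apply: mem_tilde_max => [|u w c uwT]; first by rewrite ord_neq jk.
have [hu hw] := cw_split jk c.
case: (ltngtP w i) => wi.
- by apply: (@tilde_noncrossing i u k w) => //; [rewrite /cw /=; ord_lia | exact: TT].
- case: hw => hw.
    by apply: (@tilde_noncrossing i u k w) => //; [rewrite /cw /=; ord_lia | exact: TT].
  apply: (@tilde_noncrossing i w j u) => //; first by rewrite /cw /=; ord_lia.
  by rewrite finset.setUC; exact: TT.
- have := jmax u; rewrite finset.setUC -(val_inj wi) in uwT *.
  by rewrite (TT _ uwT); ord_lia.
Qed.

(** The sides of the quadrilateral 0, i, j, k block everything that crosses one of its
    diagonals, except for the other diagonal. *)
Lemma flip_complete i j k : (0 < i < j)%N -> (j < k)%N -> [set i; k] \in T ->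
  [set ord0; i] \in tilde T -> [set ord0; k] \in tilde T ->
  [set i; j] \in tilde T -> [set j; k] \in tilde T ->
  complete_triangulation ([set ord0; j] |: (T :\ [set i; k])).
Proof.
move=> ij jk ikT t0i t0k tij tjk.
have TT d : d \in T -> d \in tilde T by rewrite inE => ->.
have cw0 : cw ord0 i j k by rewrite /cw /=; ord_lia.
have noncross0 u w : cw ord0 u j w -> [set u; w] \in T -> [set u; w] = [set i; k].
  move=> c /TT tuw; have tn a b c' d := @tilde_noncrossing a b c' d.
  have [hu hw] : (0 < u < j)%N /\ (j < w)%N by move: c; rewrite /cw /=; ord_lia.
  case: (ltngtP u i) => ui.
  - by case: (tn ord0 u i w) => //; rewrite /cw /=; ord_lia.
  - by case: (tn i u j w) => //; rewrite /cw /=; ord_lia.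
  case: (ltngtP w k) => wk.
  - by case: (tn j w k u) => //; [rewrite /cw /=; ord_lia | rewrite finset.setUC].
  - by case: (tn ord0 u k w) => //; rewrite /cw /=; ord_lia.
  by rewrite (val_inj ui) (val_inj wk).
have /completeP[/partial_triangulationP[dT ncT] mT] := cT.
apply/completeP; split.
  apply/partial_triangulationP; split.
    move=> d; rewrite !inE => /orP[/eqP ->|/andP[_ /dT //]]; exact: cw_diagonal cw0.
  have nc0 e : e \in T :\ [set i; k] -> ~~ crossing [set ord0; j] e.
    rewrite !inE => /andP[ne eT]; apply/negP => /crossing_pairP[u [w [c eE]]].
    by move: ne; rewrite eE noncross0 ?eqxx // -eE.
  move=> d e; rewrite finset.in_setU1 => /orP[/eqP ->|dT']; rewrite finset.in_setU1 => /orP[/eqP ->|eT'].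
  - exact: crossing_irrefl.
  - exact: nc0.
  - by rewrite crossingC; exact: nc0.
  - by apply: ncT; [move: dT' | move: eT']; rewrite !inE => /andP[].
move=> d dd nc; have [dT'|ndT] := boolP (d \in T).
  rewrite finset.in_setU1 finset.in_setD1 dT' andbT; case: (eqVneq d [set i; k]) => [dE|_]; last by rewrite orbT.
  exfalso.
  have := nc [set ord0; j]; rewrite setU11 => /(_ isT); rewrite dE.
  case/negP; apply/crossing_pairP; exists j, ord0; rewrite finset.setUC -cw_rot.
  by split=> //; rewrite -2!cw_rot.
have [e [eT cde]] : exists e, e \in T /\ crossing d e.
  apply: contrapT => /forallNP H; case/negP: ndT; apply: mT => // e eT.
  by apply/negP => c; apply: (H e).
have eE : e = [set i; k].
  apply: contrapT => ne; have := nc e; rewrite !inE eT andbT (_ : e != [set i; k]) ?orbT; last exact/eqP.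
  by move=> /(_ isT); rewrite cde.
move: cde; rewrite eE crossingC => /crossing_pairP[u [w [c dE]]].
have ncd (a b : vertex n) : [set a; b] \in tilde T -> [set a; b] != [set i; k] -> ~~ crossing d [set a; b].
  move=> tab nik; have [dab|] := boolP (is_diagonal [set a; b]); last first.
    by apply: contra => /crossing_diagonal[].
  apply: nc; rewrite !inE nik; move: tab; rewrite !inE.
  by have /andP[_ /negPf ->] := dab; rewrite orbF => ->; rewrite orbT.
have cross (a a' b b' : vertex n) : cw a b a' b' -> d = [set b; b'] ->
    [set a; a'] \in tilde T -> [set a; a'] != [set i; k] -> False.
  move=> c1 dE1 t1 ne; case/negP: (ncd _ _ t1 ne); rewrite dE1 crossingC.
  by apply/crossing_pairP; exists b, b'.
have ne0 (a : vertex n) : [set ord0; a] != [set i; k].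
  by apply/negP => /set2_eq E; case: E => -[E1 E2]; move: ij jk; rewrite ?E1 ?E2 /=; ord_lia.
have nij : [set i; j] != [set i; k].
  by apply/negP => /set2_eq E; case: E => -[E1 E2]; move: ij jk; rewrite ?E1 ?E2 /=; ord_lia.
have njk : [set j; k] != [set i; k].
  by apply/negP => /set2_eq E; case: E => -[E1 E2]; move: ij jk; rewrite ?E1 ?E2 /=; ord_lia.
have [hu hw] := cw_split (ltn_trans (proj2 (andP ij)) jk) c.
have dE' : d = [set w; u] by rewrite finset.setUC.
have [w0|w0] := eqVneq w ord0; last first.
  have w_gt0 : (0 < w)%N by rewrite lt0n.
  case: hw => hw; exfalso.
    by apply: (cross ord0 k u w) => //; rewrite /cw /=; ord_lia.
  by apply: (cross ord0 i w u) => //; rewrite /cw /=; ord_lia.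
case: (ltngtP u j) => uj.
- by exfalso; apply: (cross i j u w) => //; rewrite w0 /cw /=; ord_lia.
- by exfalso; apply: (cross j k u w) => //; rewrite w0 /cw /=; ord_lia.
- by rewrite dE' w0 (val_inj uj) setU11.
Qed.

End Flip.

(** For the fan at 0 an extension is given by the explicit formula; any other
    triangulation is turned into this fan by flips, each of which replaces one prescribed
    value by the one that the Pluecker relation dictates. *)
Theorem tropical_extension T (v : vset n -> int) : complete_triangulation T ->
  exists y, tropical y /\ forall d, d \in tilde T -> y d = v d.
Proof.
pose M T := [set q : vertex n | (q != ord0) && ([set ord0; q] \notin tilde T)].
have [m] := ubnP #|M T|; elim: m T v => // m IH T v lem cT.
have [noneq|[q]] := set_0Vmem (M T); last first.
  rewrite inE => /andP[q0 nq].
  have [i [j [k [ij jk ikT [t0i t0k] [tij tjk]]]]] := flippable_quad cT q0 nq.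
  have cT' := flip_complete cT ij jk ikT t0i t0k tij tjk.
  set T' := _ |: _ in cT'.
  have cw0 : cw ord0 i j k by rewrite /cw /=; ord_lia.
  have n0j : [set ord0; j] \notin tilde T.
    apply/negP => t0j; apply: (tilde_noncrossing cT cw0 t0j).
    by rewrite inE ikT.
  have sub d : d \in tilde T -> d != [set i; k] -> d \in tilde T'.
    by rewrite !inE => /orP[->|->] ->; rewrite ?orbT.
  have lt : (#|M T'| < m)%N.
    rewrite -ltnS; apply: leq_trans lem; rewrite ltnS; apply: proper_card.
    apply/fintype.properP; split.
      apply/fintype.subsetP => p; rewrite !inE => /andP[-> h] /=; apply: contra h => h.
      have := sub [set ord0; p]; rewrite !inE; apply=> //.
      by apply/negP => /set2_eq E; case: E => -[E1 E2]; move: ij jk; rewrite ?E1 ?E2 /=; ord_lia.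
    exists j; rewrite !inE; first by move: n0j; rewrite !inE => ->; rewrite -val_eqE /=; ord_lia.
    by rewrite eqxx andbF.
  (* The Pluecker relation for 0, i, j, k dictates the value at the new diagonal. *)
  pose v' d := if d == [set ord0; j] then
      Num.max (v [set ord0; i] + v [set j; k]) (v [set ord0; k] + v [set i; j]) - v [set i; k]
    else v d.
  have [y [ty yv]] := IH T' v' lt cT'; exists y; split=> // d dT.
  have y' e : e \in tilde T -> e != [set i; k] -> y e = v e.
    move=> eT ne; rewrite yv ?sub // /v' ifF //; apply/negP => /eqP E.
    by move: n0j; rewrite -E eT.
  have [->|ne] := eqVneq d [set i; k]; last exact: y'.
  have ne0 (a : vertex n) : [set ord0; a] != [set i; k].
    by apply/negP => /set2_eq E; case: E => -[E1 E2]; move: ij jk; rewrite ?E1 ?E2 /=; ord_lia.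
  have nij : [set i; j] != [set i; k].
    by apply/negP => /set2_eq E; case: E => -[E1 E2]; move: ij jk; rewrite ?E1 ?E2 /=; ord_lia.
  have njk : [set j; k] != [set i; k].
    by apply/negP => /set2_eq E; case: E => -[E1 E2]; move: ij jk; rewrite ?E1 ?E2 /=; ord_lia.
  have := ty _ _ _ _ cw0; rewrite (y' _ t0i (ne0 i)) (y' _ t0k (ne0 k)) (y' _ tij nij) (y' _ tjk njk).
  rewrite yv; last by rewrite !inE eqxx.
  have -> : v' [set ord0; j] = Num.max (v [set ord0; i] + v [set j; k])
    (v [set ord0; k] + v [set i; j]) - v [set i; k] by rewrite /v' eqxx.
  by move/eqP; rewrite addrAC subr_eq => /eqP/addrI.
exists (fan_trop_fun v); split; first exact: fan_trop_tropical.
have all0 (q : vertex n) : q != ord0 -> [set ord0; q] \in tilde T.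
  move=> q0; apply: contraT => nq; have : q \in M T by rewrite inE q0.
  by rewrite noneq inE.
move=> d dT; have [p [q [pq dE]]] : exists p q : vertex n, (p < q)%N /\ d = [set p; q].
  apply: card2_pair; move: dT; rewrite !inE => /orP[/(complete_diag cT)/is_diagonal_card //|].
  case/existsP => i /eqP ->; rewrite cards2 (_ : i != i + 1) //.
  by rewrite ord_neq vertexS; case: (ltnP i n.+2) => h; ord_lia.
rewrite dE; have [p0|p0] := eqVneq p ord0; first by rewrite p0 fan_trop_fan //; move: pq; rewrite p0.
have p_gt0 : (0 < p)%N by rewrite lt0n.
have [e|ne] := eqVneq (nat_of_ord q) p.+1; first exact: fan_trop_edge.
have vp : vx p.+1 = p.+1 :> nat by rewrite vx_small //; have := ltn_ord q; ord_lia.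
have lt_pq : (p.+1 < q)%N by rewrite ltn_neqAle eq_sym ne.
exfalso; apply: (@tilde_noncrossing T cT ord0 p (vx p.+1) q).
- apply/or4P/Or41; rewrite vp (_ : nat_of_ord ord0 = 0%N) //; ord_lia.
- by apply: all0; rewrite ord_neq vp orbT.
- by rewrite -dE.
Qed.

End Complete.

(** * Laurent expansions and tropicalization *)

Section Laurent.
Variable n : nat.
Local Notation N := n.+3.
Local Notation vx := (vx n).
Local Notation mexp := {ffun vset n -> int}.
Implicit Types (x : trop n int) (d : vset n) (T : {set vset n}) (F G H : QA n) (m : mexp).

Definition trop_path x (k : nat) (i : 'I_n) : rat := pow2 k (x [set vx 0; vx i.+2]).

Lemma growth_A x d : #|d| = 2%N -> growth (trop_path x) (Avar d) (x d).
Proof.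
move=> /card2_pair[p [q [pq ->]]]; rewrite /Avar fan_varE //.
have x0 := trop_supported x.
rewrite -{2}(vx_ord p) -{2}(vx_ord q).
apply: (@growth_fan _ (trop_path x) _ _ (fun i j => x [set vx i; vx j]) n.+2).
- move=> j hj; case: ifP => hj2.
    have hj' : (j - 2 < n)%N by lia.
    exists 1 => // k; exists (pow2 k (x [set vx 0; vx j])); rewrite !mul1r; split=> //.
    have := evalsto_indet (trop_path x k) hj'.
    by rewrite {2}/trop_path /= (_ : (j - 2).+2 = j) //; lia.
  apply: growth_eq (growth1 _) _; have [->|->] : j = 1%N \/ j = n.+2 by lia.
    by rewrite vxS (diag_supportedE x0).
  by rewrite -(vxDN n 0) add0n vxS (diag_supportedE x0).
- by move=> j hj; apply: growth_eq (growth1 _) _; rewrite vxS (diag_supportedE x0).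
- by move=> i j h1 h2; apply: trop_plucker; apply: cw_vx; lia.
- by have := ltn_ord q; lia.
Qed.

Definition lmon T m : QA n := \prod_(d in T) Avar d ^ m d.

Definition pairing m x : int := \sum_d m d * x d.

Definition exp_in T m := forall d, d \notin T -> m d = 0.

Lemma growth_lmon T m x : (forall d, d \in T -> #|d| = 2%N) -> exp_in T m ->
  growth (trop_path x) (lmon T m) (pairing m x).
Proof.
move=> T2 mT; have -> : pairing m x = \sum_(d in T) m d * x d.
  rewrite /pairing [LHS](bigID (mem T)) /= [X in _ + X]big1 ?addr0 // => d /mT ->.
  by rewrite mul0r.
by apply: growth_prod => d dT; apply: growthXz; exact: growth_A (T2 d dT).
Qed.

Lemma complete_card2 T d : complete_triangulation T -> d \in T -> #|d| = 2%N.
Proof. by move=> cT /(complete_diag cT)/is_diagonal_card. Qed.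

Lemma laurent_growth T F c x : complete_triangulation T -> laurent T F c -> F != 0 ->
  exists2 v, growth (trop_path x) F v & trop_max c x v.
Proof.
move=> cT [supp FE] F0.
have s0 : (finsupp c : seq _) != [::] by apply: contraNneq F0 => e; rewrite FE e big_nil.
have [||v [gv [m ms vE] le]] := @growth_sum _ (trop_path x) _ _ (lmon T) c (fun m => pairing m x) s0.
- by move=> m; rewrite mem_finsupp lt0n.
- by move=> m ms; apply: growth_lmon (supp m ms) => d; exact: complete_card2.
exists v; first by rewrite FE.
by split; [exists m | exact: le].
Qed.

(** All the charts give the same value, namely the rate of growth of F in the
    direction x, so the maximum that defines F^t(x) may be computed in any chart. *)
Lemma tropicalize_laurent T F c x : complete_triangulation T -> laurent T F c -> F != 0 ->
  growth (trop_path x) F (tropicalize F x) /\ trop_max c x (tropicalize F x).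
Proof.
move=> cT lF F0; have [v gv mv] := laurent_growth x cT lF F0.
suff -> : tropicalize F x = v by [].
have [T' [c' [cT' lF' mv']]] : exists T c, [/\ complete_triangulation T, laurent T F c &
    trop_max c x (tropicalize F x)].
  by apply: (@xgetPex _ 0 [set v | exists T c, [/\ complete_triangulation T, laurent T F c &
    trop_max c x v]]%classic); exists v; exists T, c.
have [v' gv' [[m1 m1s E1] le1]] := laurent_growth x cT' lF' F0.
rewrite (growth_uniq gv gv'); case: mv' => [[m2 m2s E2] le2].
by apply/eqP; rewrite eq_le {1}E2 le1 //= {1}E1 le2.
Qed.

Lemma tropicalize_ge T F c x m : complete_triangulation T -> laurent T F c -> F != 0 ->
  m \in finsupp c -> pairing m x <= tropicalize F x.
Proof. by move=> cT lF F0 ms; case: (tropicalize_laurent x cT lF F0) => _ [_]; exact. Qed.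

Lemma tropicalize_growth F x : Lplus F -> F != 0 -> growth (trop_path x) F (tropicalize F x).
Proof.
move=> LF F0; have [T cT] := complete_exists n; have [c lF] := LF T cT.
by case: (tropicalize_laurent x cT lF F0).
Qed.

(** Encoding a coefficient by repetition of its exponent makes the closure under sums
    and products immediate. *)
Definition lau T F := exists2 s : seq mexp,
  (forall m, m \in s -> exp_in T m) & F = \sum_(m <- s) lmon T m.

Lemma lmonD T m m' : lmon T [ffun d => m d + m' d] = lmon T m * lmon T m'.
Proof.
by rewrite -big_split; apply: eq_bigr => d _; rewrite ffunE expfzDr ?A_neq0.
Qed.

Lemma lau_lmon T m : exp_in T m -> lau T (lmon T m).
Proof. by move=> mT; exists [:: m]; [move=> m'; rewrite inE => /eqP -> | rewrite big_seq1]. Qed.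

Lemma lau1 T : lau T 1.
Proof.
have -> : 1 = lmon T [ffun => 0] by apply/esym/big1 => d _; rewrite ffunE expr0z.
by apply: lau_lmon => d _; rewrite ffunE.
Qed.

Lemma lmon_delta T d0 (a : int) : d0 \in T -> lmon T [ffun d => (d == d0)%:Z * a] = Avar d0 ^ a.
Proof.
move=> dT; rewrite /lmon (bigD1 d0) //= ffunE eqxx mul1r big1 ?mulr1 // => d /andP[_ /negPf ne].
by rewrite ffunE ne mul0r expr0z.
Qed.

Lemma lau_var T d0 (a : int) : d0 \in T -> lau T (Avar d0 ^ a).
Proof.
move=> dT; rewrite -(lmon_delta a dT); apply: lau_lmon => d ndT; rewrite ffunE.
by case: eqP => [e|_]; [rewrite e dT in ndT | rewrite mul0r].
Qed.

Lemma lauD T F G : lau T F -> lau T G -> lau T (F + G).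
Proof.
move=> [s sT ->] [t tT ->]; exists (s ++ t); last by rewrite big_cat.
by move=> m; rewrite mem_cat => /orP[/sT|/tT].
Qed.

Lemma lauM T F G : lau T F -> lau T G -> lau T (F * G).
Proof.
move=> [s sT ->] [t tT ->]; exists [seq ([ffun d => m d + m' d] : mexp) | m <- s, m' <- t].
  move=> _ /allpairsP[[m m'] /= [/sT ms /tT mt ->]] d dT.
  by rewrite ffunE ms ?mt // addr0.
rewrite big_allpairs_dep big_distrl /=; apply: eq_bigr => m _; rewrite big_distrr /=.
by apply: eq_bigr => m' _; rewrite lmonD.
Qed.

Lemma lau_laurent T F : lau T F -> exists c, laurent T F c.
Proof.
move=> [s sT ->].
pose c : {fsfun mexp -> nat with 0%N} := [fsfun m in seq_fset tt s => count_mem m s].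
have cE m : c m = count_mem m s.
  rewrite fsfunE seq_fsetE; case: ifP => // /negbT; rewrite -has_pred1 has_count.
  by rewrite -eqn0Ngt => /eqP ->.
have cs m : (m \in finsupp c) = (m \in s).
  by rewrite mem_finsupp cE -[m \in s]has_pred1 has_count lt0n.
exists c; split; first by move=> m; rewrite cs => /sT h d; exact: h.
rewrite -big_undup_iterop_count.
transitivity (\sum_(m <- undup s) lmon T m *+ count_mem m s).
  by apply: eq_bigr => m _; elim: (count_mem m s) => [|[|k] IHk] //; rewrite mulrS -IHk.
rewrite [RHS](perm_big (undup s)); last first.
  by apply: uniq_perm; rewrite ?undup_uniq ?fset_uniq // => m; rewrite mem_undup cs.
by apply: eq_bigr => m _; rewrite cE.
Qed.

(** Positivity of the Laurent expansions of the segment variables: a diagonal that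
    crosses jl in T is (A_ij A_kl + A_il A_jk) / A_jl, where the numerator is known
    to be positive by induction on the number of crossings. *)
Lemma Avar_Lplus d : #|d| = 2%N -> Lplus (Avar d).
Proof.
move=> /card2_pair[p [q [pq ->]]] T cT; apply: lau_laurent.
have /completeP[/partial_triangulationP[dT ncT] mT] := cT.
have pq' : p != q by rewrite ord_neq pq.
move: p q pq' {pq}; apply: (@seg_ind n T (fun d => lau T (Avar d)) ncT).
  move=> p q pq nc; case: (boolP (is_diagonal [set p; q])) => dd.
    by rewrite -[Avar _]expr1z; apply: lau_var; exact: mT.
  by rewrite A_edge ?edge_pair //; exact: lau1.
move=> i j k l c jlT ij kl il jk.
have -> : Avar [set i; k] = (Avar [set i; j] * Avar [set k; l] +
    Avar [set i; l] * Avar [set j; k]) * Avar [set j; l] ^ (-1).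
  by rewrite -A_plucker // exprN1 mulfK ?A_neq0.
apply: lauM; last exact: lau_var.
by apply: lauD; apply: lauM.
Qed.

Lemma tropicalize_Avar d x : #|d| = 2%N -> tropicalize (Avar d) x = x d.
Proof.
move=> d2; apply: growth_uniq (tropicalize_growth x (Avar_Lplus d2) _) (growth_A x d2).
exact: A_neq0.
Qed.

(** Prescribing 0 on the edges makes the extension a tropical point. *)
Lemma trop_extension T (v : vset n -> int) : complete_triangulation T ->
  exists x, forall d, d \in T -> x d = v d.
Proof.
move=> cT; have [y [ty yv]] := tropical_extension (fun d => if d \in T then v d else 0) cT.
pose y0 d := if is_diagonal d then y d else 0.
have y0E p q : p != q -> y0 [set p; q] = y [set p; q].
  move=> pq; rewrite /y0; case: ifP => // /negbT ndd.
  rewrite yv; last by rewrite mem_tilde // ndd orbT.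
  by rewrite ifF //; apply: contraNF ndd => /(complete_diag cT).
have [||x xy] := @mk_trop n y0.
- by move=> d; rewrite /y0 => /negPf ->.
- move=> i j k l c; rewrite !y0E; first exact: ty;
    by rewrite ord_neq; move: c; rewrite /cw; lia.
by exists x => d dT; rewrite xy /y0 (complete_diag cT dT) yv ?inE ?dT.
Qed.

Lemma diagonal_triangulation d : is_diagonal d ->
  exists2 T, complete_triangulation T & d \in T.
Proof.
move=> dd; have [|T cT sub] := @complete_extension n [set d].
  apply/partial_triangulationP; split=> [e|e f]; rewrite !inE => /eqP -> //.
  by move/eqP ->; exact: crossing_irrefl.
by exists T => //; apply: (fintype.subsetP sub); rewrite inE.
Qed.

(** If A_d = G + H in L_+, then in a chart containing d every monomial of G is
    tropically at most A_d at every point, hence it is A_d itself: both summands are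
    multiples of A_d by positive integers, which is impossible. *)
Lemma Avar_indecomposable d : is_diagonal d -> indecomposable (Avar d).
Proof.
move=> dd; have d2 := is_diagonal_card dd.
split; [exact: Avar_Lplus | exact: A_neq0 |].
move=> [G [H [LG LH G0 H0 E]]].
have [T cT dT] := diagonal_triangulation dd.
have part G1 H1 : Lplus G1 -> Lplus H1 -> G1 != 0 -> H1 != 0 -> Avar d = G1 + H1 ->
    exists2 a, (0 < a)%N & G1 = Avar d *+ a.
  move=> LG1 LH1 G10 H10 E1; have [c lG] := LG1 T cT.
  have bound x m : m \in finsupp c -> pairing m x <= x d.
    move=> mc; apply: (le_trans (tropicalize_ge x cT lG G10 mc)).
    have := growthD (tropicalize_growth x LG1 G10) (tropicalize_growth x LH1 H10).
    by rewrite -E1 => g; rewrite (growth_uniq (growth_A x d2) g) le_max lexx.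
  have mE m : m \in finsupp c -> m = [ffun e => (e == d)%:Z * 1].
    move=> mc; apply/ffunP => e; rewrite ffunE mulr1.
    have mT := lG.1 m mc.
    have [eT|eT] := boolP (e \in T); last first.
      by rewrite mT //; case: eqP => // ed; rewrite ed dT in eT.
    (* The points with value t = 1 or -1 at e and 0 elsewhere on T bound m e on both sides. *)
    have test (t : int) : m e * t <= (e == d)%:Z * t.
      have [x xE] := trop_extension (fun f => (f == e)%:Z * t) cT.
      have := bound x m mc; rewrite xE // (eq_sym d).
      rewrite /pairing (bigD1 e) //= xE // eqxx mul1r big1 ?addr0 // => f fe.
      have [fT|/mT ->] := boolP (f \in T); last by rewrite mul0r.
      by rewrite xE // (negPf fe) mul0r mulr0.
    by have := test 1; have := test (-1); move: (m e) ((e == d)%:Z) => a b; lia.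
  have [_ GE] := lG.
  exists (\sum_(m <- finsupp c) c m)%N.
    rewrite lt0n; apply: contraNneq G10 => s0; rewrite GE big_seq big1 // => m mc.
    move/eqP: s0; rewrite sum_nat_seq_eq0 => /allP/(_ m mc)/=/eqP ->.
    by rewrite mulr0n.
  rewrite GE -sumrMnr big_seq [RHS]big_seq; apply: eq_bigr => m /mE ->.
  by rewrite -/(lmon T _) lmon_delta // expr1z.
have [a a0 GE] := part G H LG LH G0 H0 E.
have [b b0 HE] : exists2 b, (0 < b)%N & H = Avar d *+ b.
  by apply: (part H G) => //; rewrite addrC.
have [k ab] : exists k, (a + b = k.+2)%N by exists (a + b).-2; lia.
have [x _] := trop_extension (fun=> 0) cT.
have := growth_neq0 (growth_natmul (isT : 0 < k.+1)%N (growth_A x d2)); case/eqP.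
by apply: (@addrI _ (Avar d)); rewrite -mulrS -ab mulrnDr -GE -HE addr0.
Qed.

End Laurent.

(** * The tropical inequality for positive functions *)

Section Support.
Variable n : nat.
Local Notation N := n.+3.
Local Notation vx := (vx n).
Implicit Types (x z : trop n int) (p q i j k l : vertex n) (d : vset n)
  (T : {set vset n}) (y : vset n -> int) (g : vertex n -> vertex n -> int).

Definition gsupp g : {set vset n} :=
  [set d | [exists p, exists q, [&& d == [set p; q], is_diagonal d & 0 < g p q]]].

Definition wsupp y := gsupp (IA_exponent y).

Lemma mem_gsupp g d : reflect (exists p q, [/\ d = [set p; q], is_diagonal d & 0 < g p q])
  (d \in gsupp g).
Proof.
rewrite inE; apply: (iffP existsP) => [[p /existsP[q /and3P[/eqP]]]|[p [q [dE dd h]]]].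
  by exists p, q.
by exists p; apply/existsP; exists q; rewrite -dE eqxx dd h.
Qed.

Lemma gsupp_partial g : (forall p q, g p q = g q p) ->
  (forall i j k l, cw i j k l -> 0 < g i k -> 0 < g j l -> False) ->
  partial_triangulation (gsupp g).
Proof.
move=> gC nc; apply/partial_triangulationP; split; first by move=> d /mem_gsupp[p [q []]].
move=> d e /mem_gsupp[p [q [-> _ gpq]]] /mem_gsupp[r [s [-> _ grs]]].
apply/negP => /crossingP[i [j [k [l [c /eqP/set2_eq E1 /eqP/set2_eq E2]]]]].
have gik : 0 < g i k by case: E1 => -[-> ->]; rewrite // gC.
have gjl : 0 < g j l by case: E2 => -[-> ->]; rewrite // gC.
exact: nc c gik gjl.
Qed.

Lemma wsupp_partial y : tropical y -> partial_triangulation (wsupp y).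
Proof.
move=> ty; apply: gsupp_partial; first exact: IA_exponentC.
by move=> i j k l; exact: tropical_noncrossing.
Qed.

Lemma cw_shift i j k l : cw i j k l -> cw (i + 1) (j + 1) (k + 1) (l + 1).
Proof.
by case/cw_lift=> P [Q] [R] [S] [h1 h2 -> -> [-> ->]]; rewrite -!vxS; apply: cw_vx; lia.
Qed.

Lemma is_diagonal_shift p q : is_diagonal [set p + 1; q + 1] = is_diagonal [set p; q].
Proof. by rewrite !is_diagonal_pair !(inj_eq (addIr _)). Qed.

Lemma sum_pairs_sets (f : vset n -> int) : (forall d, ~~ is_diagonal d -> f d = 0) ->
  \sum_p \sum_q f [set p; q] = (\sum_d f d) * 2.
Proof.
move=> f0; rewrite sum_pairs_sym; last 2 first.
- by move=> p q; rewrite finset.setUC.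
- by move=> p; exact/f0/nondiag_loop.
congr (_ * 2); rewrite pair_big_dep /=.
transitivity (\sum_(u : vertex n * vertex n | (u.1 < u.2)%N) \sum_(d | d == [set u.1; u.2]) f d).
  by apply: eq_bigr => u _; rewrite big_pred1_eq.
rewrite (exchange_big_dep xpredT) //=; apply: eq_bigr => d _.
case: (boolP (is_diagonal d)) => [|dd]; last by rewrite f0 // big1.
move=> /is_diagonal_card/card2_pair[p [q [pq dE]]].
rewrite (big_pred1 (p, q)) // => -[a b] /=; rewrite dE xpair_eqE.
apply/andP/andP => [[ab /set2_eq]|[/eqP -> /eqP ->]]; last by rewrite pq eqxx.
case=> -[E1 E2]; first by rewrite E1 E2 !eqxx.
by move: ab; rewrite E1 E2 ltnNge ltnW.
Qed.

(** The potential is a double sum over initial segments of the vertices. It has to be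
    periodic, and it is once the values of m at the loops, which are free, are
    chosen to make all the row sums vanish. *)
Lemma potential_exists (m : vset n -> int) : exists b : vset n -> int,
  forall p q, is_diagonal [set p; q] -> IA_exponent b (p + 1) (q + 1) = m [set p; q].
Proof.
pose mb p q : int := if p == q then - \sum_(u | u != p) m [set p; u] else m [set p; q].
have mbC p q : mb p q = mb q p by rewrite /mb eq_sym; case: eqVneq => [->|_] //; rewrite finset.setUC.
have row p : \sum_q mb p q = 0.
  rewrite (bigD1 p) //= {1}/mb eqxx addrC; apply/eqP; rewrite subr_eq0; apply/eqP.
  by apply: eq_bigr => q qp; rewrite /mb eq_sym (negPf qp).
have initial (f : vertex n -> int) p : \sum_s f s = 0 ->
    \sum_(s : vertex n | (s < (p + 1)%R)%N) f s = \sum_(s : vertex n | (s < p)%N) f s + f p.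
  move=> s0; rewrite vertexS; case: ltnP => hp.
    rewrite (bigD1 p) //= addrC; congr (_ + _); apply: eq_bigl => s.
    by rewrite -val_eqE /= ltnS; lia.
  rewrite big_pred0 // -[LHS]s0 (bigD1 p) //= addrC; congr (_ + _); apply: eq_bigl => s.
  by rewrite -val_eqE /=; have := ltn_ord s; have := ltn_ord p; lia.
pose B p q := \sum_(s : vertex n | (s < p)%N) \sum_(t : vertex n | (t < q)%N) mb s t.
have BC p q : B p q = B q p.
  rewrite /B exchange_big /=; apply: eq_bigr => s _; apply: eq_bigr => t _; exact: mbC.
exists (sym_fun B) => p q dpq; have dpq' := dpq.
move: dpq'; rewrite is_diagonal_pair => /and3P[h1 h2 h3].
have n1 : p + 1 != q + 1 by rewrite (inj_eq (addIr _)).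
rewrite IA_exponentS !sym_fun_pair // 1?(eq_sym (p + 1)) //.
have BS p' q' : B (p' + 1) q' = B p' q' + \sum_(t : vertex n | (t < q')%N) mb p' t.
  rewrite {1}/B initial //.
  by rewrite exchange_big big1 // => t _; rewrite -[RHS](row t); apply: eq_bigr => s _; rewrite mbC.
rewrite !BS initial //.
have -> : mb p q = m [set p; q] by rewrite /mb (negPf h1).
ring.
Qed.

(** Solving a Pluecker relation is a Lipschitz operation that commutes with
    multiplication by K >= 0, so an estimate on T propagates by induction on the number of
    crossings, with a constant that depends neither on K nor on z. *)
Lemma trop_lipschitz T x (C : int) : complete_triangulation T -> exists C' : int,
  forall (K : int) z, 0 <= K -> (forall d, d \in T -> `|z d - K * x d| <= C) ->
  forall p q, `|z [set p; q] - K * x [set p; q]| <= C'.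
Proof.
move=> cT; have /completeP[/partial_triangulationP[dT ncT] mT] := cT.
pose Q d C' := forall (K : int) z, 0 <= K -> (forall d, d \in T -> `|z d - K * x d| <= C) ->
  `|z d - K * x d| <= C'.
have step p q : p != q -> exists C', Q [set p; q] C'.
  move: p q; apply: (@seg_ind n T (fun d => exists C', Q d C') ncT) => [p q pq nc|].
    case: (boolP (is_diagonal [set p; q])) => dd.
      by exists C => K z _; apply; exact: mT.
    by exists 0 => K z _ _; rewrite !trop_nondiag // mulr0 subrr normr0.
  move=> i j k l c jlT [C1 Q1] [C2 Q2] [C3 Q3] [C4 Q4].
  exists (`|C1| + `|C2| + `|C3| + `|C4| + C) => K z K0 zK.
  have := Q1 K z K0 zK; have := Q2 K z K0 zK; have := Q3 K z K0 zK; have := Q4 K z K0 zK.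
  have := zK _ jlT; have Ez := trop_plucker z c.
  have Ex : K * x [set i; k] + K * x [set j; l] = Num.max (K * x [set i; j] + K * x [set k; l])
      (K * x [set i; l] + K * x [set j; k]).
    by rewrite -!mulrDr trop_plucker // maxr_pMr.
  move: Ez Ex.
  move: (K * x [set i; k]) (K * x [set j; l]) (K * x [set i; j]) (K * x [set k; l])
    (K * x [set i; l]) (K * x [set j; k]) (z [set i; k]) (z [set j; l]) (z [set i; j])
    (z [set k; l]) (z [set i; l]) (z [set j; k]) => a1 a2 a3 a4 a5 a6 b1 b2 b3 b4 b5 b6.
  by clear; lia.
have pick_bound (u : vertex n * vertex n) :
    exists C', u.1 != u.2 -> Q [set u.1; u.2] C'.
  by case: (boolP (u.1 != u.2)) => [/step[C' QC']|_]; [exists C' | exists 0].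
have [f Qf] := choice pick_bound.
exists (\sum_u `|f u|) => K z K0 zK p q.
have le0 : 0 <= \sum_u `|f u| by apply: sumr_ge0.
have [<-|pq] := eqVneq p q; first by rewrite !trop_nondiag ?nondiag_loop // mulr0 subrr normr0.
apply: (le_trans (Qf (p, q) pq K z K0 zK)); apply: le_trans (ler_norm _) _.
by rewrite (bigD1 (p, q)) //= lerDl sumr_ge0.
Qed.

(** Such a point is in the interior of a cone of linearity: a positive second difference
    stays positive nearby, so all the nearby points have the same support. *)
Definition maximal_support x := forall z, wsupp x \subset wsupp z -> wsupp z = wsupp x.

Lemma maximal_support_exists x : exists2 z, maximal_support z & wsupp x \subset wsupp z.
Proof.
have [|S /maxsetP[/asboolP[z zS] mS] xS] :=
  @maxset_exists _ (fun S => `[< exists z : trop n int, wsupp z = S >]) (wsupp x).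
  by apply/asboolP; exists x.
exists z; last by rewrite zS.
move=> w; rewrite zS => /mS; apply; apply/asboolP; by exists w.
Qed.

Lemma IA_exponent_scale (K : int) x z p q :
  IA_exponent (fun d => K * x d + z d) p q = K * IA_exponent x p q + IA_exponent z p q.
Proof. by rewrite /IA_exponent; ring. Qed.

(** Second differences are linear, so the combination has its support in that of z, which
    is noncrossing. *)
Lemma trop_cone x z (K : nat) : wsupp x \subset wsupp z ->
  exists w : trop n int, forall d, w d = K%:Z * x d + z d.
Proof.
move=> xz; apply: mk_trop; first by move=> d dd; rewrite !trop_nondiag // mulr0 addr0.
have [wx wz] := (tropical_wpos (@trop_tropical _ x), tropical_wpos (@trop_tropical _ z)).
have pos p q : is_diagonal [set p; q] ->
    0 < IA_exponent (fun d => K%:Z * x d + z d) p q -> 0 < IA_exponent z p q.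
  move=> dd; rewrite IA_exponent_scale => h.
  have [xpos|x0] := ltrP 0 (IA_exponent x p q).
    have : [set p; q] \in wsupp z.
      by apply: (fintype.subsetP xz); apply/mem_gsupp; exists p, q.
    move=> /mem_gsupp[p' [q' [/eqP/set2_eq E _]]].
    by case: E => -[-> ->] //; rewrite IA_exponentC.
  have e : IA_exponent x p q = 0 by apply/eqP; rewrite eq_le x0 wx.
  by move: h; rewrite e mulr0 add0r.
apply: noncrossing_tropical => [p q dd|i j k l c h1 h2].
  by rewrite IA_exponent_scale addr_ge0 ?mulr_ge0 ?wx ?wz.
have c' : cw j k l i by rewrite -cw_rot.
apply: (tropical_noncrossing (@trop_tropical _ z) c); apply: pos => //.
  exact: cw_diagonal c.
exact: cw_diagonal c'.
Qed.

End Support.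

Lemma amplified_bound (k gw gs gz Fw Fx Fz s t : int) : 0 <= k ->
  gw <= k * gs + gz -> gs <= s * 2 -> k * Fx + t <= Fw -> gw = Fw * 2 -> gz <= Fz * 2 ->
  k * (Fx - s) <= Fz - t.
Proof.
move=> k0 h1 h2 h3 h4 h5; have h6 := ler_wpM2l k0 h2.
by rewrite mulrA in h6; rewrite mulrBr; lia.
Qed.

Lemma le0_of_multiples (a b : int) : (forall K : nat, K%:Z * a <= b) -> a <= 0.
Proof.
move=> bound; rewrite leNgt; apply/negP => a0; have := bound (absz b).+1.
have : (absz b).+1%:Z <= (absz b).+1%:Z * a by rewrite ler_peMr.
by move: (_ * a) => t; lia.
Qed.

Section Subadditivity.
Variable n : nat.
Local Notation N := n.+3.
Local Notation mexp := {ffun vset n -> int}.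
Implicit Types (x z : trop n int) (p q : vertex n) (F : QA n).

Definition gpair (g : vertex n -> vertex n -> int) (a : vset n -> int) : int :=
  \sum_p \sum_q g p q * a [set p; q].

Lemma gpair_lin g (K : int) a a' :
  gpair g (fun d => K * a d + a' d) = K * gpair g a + gpair g a'.
Proof.
rewrite /gpair mulr_sumr -big_split /=; apply: eq_bigr => p _.
rewrite mulr_sumr -big_split /=; apply: eq_bigr => q _; ring.
Qed.

(** A monomial m of F that is maximal at x is rewritten, on the cone of
    linearity of x, as the pairing with the second differences g of a tropical
    function y, which are nonnegative on the diagonals and supported in a
    triangulation. At x both sides agree with F^t. To
    compare them at another point z, consider the point w with coordinates K x + z in that
    triangulation, for K large: it lies in the cone of x, so the pairing at w is at most
    F^t(w), which by convexity is at most K F^t(x) + F^t(z). The factor 2 appears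
    because g is summed over ordered pairs of vertices. *)
Lemma supporting_monomial F x : Lplus F -> F != 0 -> maximal_support x ->
  exists g : vertex n -> vertex n -> int,
  [/\ forall p q, is_diagonal [set p; q] -> 0 <= g p q,
      forall z, gpair g z <= tropicalize F z * 2 &
      gpair g x = tropicalize F x * 2].
Proof.
move=> LF F0 mx; have [T cT] := complete_exists n; have [c lF] := LF T cT.
have [_ [[m mc Fx] _]] := tropicalize_laurent x cT lF F0.
have Fm z : pairing m z <= tropicalize F z by exact: tropicalize_ge lF F0 mc.
have [D cD xD] := complete_extension (wsupp_partial (@trop_tropical _ x)).
(* On the points whose support is in D, only the values of b on D matter, and they
   can be extended to a tropical function. *)
have [b bE] := potential_exists m.
have [y [ty yD]] := tropical_extension b cD.
pose g p q := IA_exponent y (p + 1) (q + 1).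
have g_ge0 p q : is_diagonal [set p; q] -> 0 <= g p q.
  by rewrite -is_diagonal_shift; exact: tropical_wpos ty _ _.
have gD z : wsupp z = wsupp x -> gpair g z = pairing m z * 2.
  move=> zx; transitivity (\sum_p \sum_q z [set p; q] * IA_exponent y (p + 1) (q + 1)).
    by apply: eq_bigr => p _; apply: eq_bigr => q _; rewrite mulrC.
  rewrite -IA_exponent_adjoint.
  transitivity (\sum_p \sum_q IA_exponent z p q * b [set p; q]).
    apply: eq_bigr => p _; apply: eq_bigr => q _.
    have [<-|pq] := eqVneq p q; first by rewrite IA_exponent_loop ?mul0r //; exact: trop_supported.
    case: (boolP ([set p; q] \in tilde D)) => [/yD -> //|].
    rewrite mem_tilde // negb_or negbK => /andP[nD dd].
    suff -> : IA_exponent z p q = 0 by rewrite !mul0r.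
    apply/eqP; rewrite eq_le (tropical_wpos (@trop_tropical _ z)) // andbT leNgt.
    apply: contra nD => h; apply: (fintype.subsetP xD); rewrite -zx.
    by apply/mem_gsupp; exists p, q.
  rewrite IA_exponent_adjoint -sum_pairs_sets; last by move=> d dd; rewrite (trop_nondiag z) // mulr0.
  apply: eq_bigr => p _; apply: eq_bigr => q _.
  case: (boolP (is_diagonal [set p; q])) => [/bE ->|dd]; first by rewrite mulrC.
  by rewrite (trop_nondiag z) // mul0r mulr0.
exists g; split=> //; last by rewrite gD // Fx.
have pg : partial_triangulation (gsupp g).
  apply: gsupp_partial => [p q|i j k l c0]; first exact: IA_exponentC.
  exact: tropical_noncrossing ty (cw_shift c0).
have [Ty cTy gTy] := complete_extension pg; have [cy lFy] := LF Ty cTy.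
have g0 p q : [set p; q] \notin Ty -> is_diagonal [set p; q] -> g p q = 0.
  move=> nT dd; apply/eqP; rewrite eq_le g_ge0 // andbT leNgt.
  by apply: contra nT => h; apply: (fintype.subsetP gTy); apply/mem_gsupp; exists p, q.
move=> z.
have [C' lip] := trop_lipschitz x (\sum_d `|z d|) cTy.
have C'0 : 0 <= C'.
  have [x0 x0E] := trop_extension (fun d => 0 * x d + z d) cTy.
  apply: le_trans (normr_ge0 _) (lip 0 x0 (lexx _) _ ord0 ord0) => d dT.
  by rewrite x0E // addrC addKr (bigD1 d) //= lerDl sumr_ge0.
(* A second difference involves four values, each of which is known up to C'. *)
pose K := 4 * C' + 1; have K0 : 0 <= K by rewrite /K; lia.
have [w wE] := trop_extension (fun d => K * x d + z d) cTy.
have near : forall p q, `|w [set p; q] - K * x [set p; q]| <= C'.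
  by apply: lip => // d dT; rewrite wE // addrC addKr (bigD1 d) //= lerDl sumr_ge0.
have wx : wsupp w = wsupp x.
  apply: mx; apply/fintype.subsetP => d /mem_gsupp[p [q [dE dd h]]].
  apply/mem_gsupp; exists p, q; split=> //.
  have := near (q - 1) (p - 1); have := near p q; have := near p (q - 1); have := near (p - 1) q.
  have hK : K <= K * IA_exponent x p q by rewrite ler_peMr //; lia.
  move: hK; rewrite /IA_exponent !mulrBr mulrDr.
  move: (K * x [set q - 1; p - 1]) (K * x [set p; q]) (K * x [set p; q - 1]) (K * x [set p - 1; q])
   (w [set q - 1; p - 1]) (w [set p; q]) (w [set p; q - 1]) (w [set p - 1; q]) => a1 a2 a3 a4 b1 b2 b3 b4.
  by rewrite /K; clear; lia.
have gw : gpair g w = K * gpair g x + gpair g z.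
  rewrite -gpair_lin; apply: eq_bigr => p _; apply: eq_bigr => q _.
  case: (boolP ([set p; q] \in Ty)) => [/wE -> //|nT].
  case: (boolP (is_diagonal [set p; q])) => dd; first by rewrite g0 // !mul0r.
  by rewrite (trop_nondiag w) // (trop_nondiag x) // (trop_nondiag z) //; ring.
have Fw : tropicalize F w <= K * tropicalize F x + tropicalize F z.
  have [_ [[m' m'c ->] _]] := tropicalize_laurent w cTy lFy F0.
  have -> : \sum_d m' d * w d = K * pairing m' x + pairing m' z.
    rewrite /pairing mulr_sumr -big_split; apply: eq_bigr => d _ /=.
    have [/wE ->|ndT] := boolP (d \in Ty); first by ring.
    by rewrite lFy.1 // !mul0r mulr0 addr0.
  by rewrite lerD ?ler_wpM2l ?(tropicalize_ge _ cTy lFy F0).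
have {}Fx : tropicalize F x = pairing m x by [].
have := Fm w; rewrite (gD w wx) (gD x erefl) mulrA in gw; rewrite Fx in Fw.
move: gw Fw; move: (tropicalize F w) (tropicalize F z) (gpair g z) (pairing m w) (K * pairing m x).
by clear => a1 a2 a3 a4 a5; lia.
Qed.

(** At a point of maximal support the inequality holds because F^t is supported from
    below there by a nonnegative combination of coordinates. The general case follows
    from the points K x + z, with z of maximal support, by letting K grow. *)
Theorem tropicalize_subadditive (m : nat) (l : 'I_m -> trop n int) F x :
  Lplus F -> F != 0 -> (forall d, is_diagonal d -> x d <= sum_trop l d) ->
  tropicalize F x <= \sum_(i < m) tropicalize F (l i).
Proof.
move=> LF F0 xl.
have [z mz xz] := maximal_support_exists x.
have [T cT] := complete_exists n; have [c lF] := LF T cT.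
have [_ [[m0 m0c Fx] _]] := tropicalize_laurent x cT lF F0.
have bound (K : nat) : K%:Z * (tropicalize F x - \sum_(i < m) tropicalize F (l i)) <=
    tropicalize F z - pairing m0 z.
  have [w wE] := trop_cone K xz.
  have wz : wsupp w = wsupp z.
    apply: mz; apply/fintype.subsetP => d /mem_gsupp[p [q [dE dd h]]].
    apply/mem_gsupp; exists p, q; split=> //.
    rewrite (_ : IA_exponent w p q = IA_exponent (fun d => K%:Z * x d + z d) p q); last first.
      by rewrite /IA_exponent !wE.
    rewrite IA_exponent_scale ltr_wpDl // mulr_ge0 //.
    by apply: tropical_wpos; [exact: trop_tropical | rewrite -dE].
  have mw : maximal_support w by move=> u; rewrite wz; exact: mz.
  have [g [g0 gF gw]] := supporting_monomial LF F0 mw.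
  have lower : K%:Z * tropicalize F x + pairing m0 z <= tropicalize F w.
    apply: le_trans (tropicalize_ge w cT lF F0 m0c); rewrite Fx /pairing mulr_sumr -big_split.
    by apply: ler_sum => d _ /=; rewrite wE mulrDr mulrCA.
  have upper : gpair g w <= K%:Z * gpair g (sum_trop l) + gpair g z.
    rewrite -gpair_lin; apply: ler_sum => p _; apply: ler_sum => q _; rewrite wE.
    case: (boolP (is_diagonal [set p; q])) => dd.
      by rewrite ler_wpM2l ?g0 // lerD2r ler_wpM2l // xl.
    by rewrite (trop_nondiag x) // sum_trop_supported.
  have gl : gpair g (sum_trop l) = \sum_(i < m) gpair g (l i).
    rewrite /gpair [RHS]exchange_big /=; apply: eq_bigr => p _.
    rewrite [RHS]exchange_big /=; apply: eq_bigr => q _; by rewrite /sum_trop mulr_sumr.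
  have gl_le : gpair g (sum_trop l) <= (\sum_(i < m) tropicalize F (l i)) * 2.
    by rewrite gl mulr_suml; apply: ler_sum => i _; exact: gF.
  exact: (@amplified_bound K _ _ _ _ _ _ _ _ (le0z_nat K) upper gl_le lower gw (gF z)).
by rewrite -subr_le0; exact: le0_of_multiples bound.
Qed.

End Subadditivity.

(** * The theorem *)

Lemma minkowski_sumE (n m : nat) (l : 'I_m -> trop n int) :
  minkowski_sum l = [set x : trop n int | forall d, is_diagonal d -> x d <= sum_trop l d]%classic.
Proof.
apply/seteqP; split=> x /= h.
  move=> d dd; have := h _ (Avar_indecomposable dd).
  rewrite tropicalize_Avar ?is_diagonal_card //; congr (_ <= _).
  by apply: eq_bigr => i _; rewrite tropicalize_Avar ?is_diagonal_card.
by move=> F [LF F0 _]; exact: tropicalize_subadditive.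
Qed.

Theorem theorem1p1 (R : realType) (n m : nat) (n_gt0 : (1 <= n)%N)
    (l : 'I_m -> trop n int) :
  exists2 c : {fsfun trop n int -> int with 0},
    unique (canonical_expansion (\prod_(i < m) IA (l i))) c &
    let S := [set x | c x != 0]%classic in
    [/\ S = minkowski_sum l,
        S = [set x : trop n int | forall d : vset n, is_diagonal d ->
               x d <= \sum_(i < m) l i d]%classic &
        integral_stasheff_polytope R S].
Proof.
have [c Ec cP] := canonical_expansion_exists l.
exists c; first by split=> // c' Ec'; exact: canonical_expansion_unique Ec Ec'.
have SE : [set x | c x != 0]%classic =
    [set x : trop n int | forall d, is_diagonal d -> x d <= sum_trop l d]%classic.
  by apply/seteqP; split=> x /= /cP.
by split; rewrite SE ?minkowski_sumE //; exact: stasheff_sum_trop.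
Qed.
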